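(* Let $K$ be a field endowed with a rank-one valuation, with valuation domain $V$, and let $E$ be a subset of $V$. If $\mathrm{Int}(E,V)$ is a Prüfer domain, then $\mathrm{Int}(E,V)$ has the stacked bases property.
   Context: A rank-one valuation $v$ on $K$ is one for which $v(K^* )$ is a nonzero subgroup of $(\mathbb R,+)$. $\mathrm{Int}(E,V)=\{f\in K[X]\mid f(E)\subseteq V\}$. An integral domain $D$ has the stacked bases property if, for every free $D$-module $M$ of finite rank $m$ and every finitely generated submodule $N$ of $M$ of rank $n\le m$, there exist rank-one projective $D$-modules $P_1,\dots,P_m$ and nonzero ideals $\mathfrak I_1,\dots,\mathfrak I_n$ of $D$ such that $M=P_1\oplus\cdots\oplus P_m$ (internal direct sum of submodules), $N=\mathfrak I_1P_1\oplus\cdots\oplus\mathfrak I_nP_n$, and $\mathfrak I_{j+1}\subseteq\mathfrak I_j$ for $1\le j\le n-1$. *)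

(* Defs.v *)
From HB Require Import structures.
From mathcomp Require Import all_boot all_order all_algebra.
From mathcomp Require Import boolp classical_sets constructive_ereal reals.
Set Implicit Arguments. Unset Strict Implicit. Unset Printing Implicit Defensive.
Import Order.TTheory GRing.Theory Num.Theory.
Local Open Scope ring_scope.

Section Modules.
Variable D : idomainType.

Definition generates (M : lmodType D) (n : nat) (b : 'I_n -> M) : Prop :=
  forall x : M, exists c : 'I_n -> D, x = \sum_i c i *: b i.

Definition lin_indep (M : lmodType D) (n : nat) (b : 'I_n -> M) : Prop :=
  forall c : 'I_n -> D, \sum_i c i *: b i = 0 -> forall i, c i = 0.

Definition fin_gen (M : lmodType D) : Prop :=
  exists (n : nat) (b : 'I_n -> M), generates b.

Definition free_of_rank (M : lmodType D) (m : nat) : Prop :=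
  exists b : 'I_m -> M, generates b /\ lin_indep b.

(* The rank of a module over the domain D is the maximal number of linearly
   independent elements. *)
Definition has_rank (M : lmodType D) (n : nat) : Prop :=
  (exists b : 'I_n -> M, lin_indep b) /\
  (forall (k : nat) (b : 'I_k -> M), lin_indep b -> (k <= n)%N).

Definition projective (P : lmodType D) : Prop :=
  forall (A B : lmodType D) (g : {linear A -> B}) (f : {linear P -> B}),
    (forall y, exists x, g x = y) ->
    exists h : {linear P -> A}, forall p, g (h p) = f p.

(* A submodule is a library [submodClosed] predicate; [submod_of N] is N viewed
   as a module in its own right. *)
Record submod_of (M : lmodType D) (N : submodClosed M) := SubmodOf {
  submod_val :> M;
  submod_valP : submod_val \in N }.

Section SubmodOf.
Variables (M : lmodType D) (N : submodClosed M).
HB.instance Definition _ := [isSub for @submod_val M N].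
HB.instance Definition _ := [Choice of submod_of N by <:].
HB.instance Definition _ := [SubChoice_isSubLmodule of submod_of N by <:].
End SubmodOf.

(* The library's [idealr] only covers proper ideals, whereas D itself must be
   allowed here. *)
Definition ideal : Type := submodClosed D^o.

Definition nonzero_ideal (I : ideal) : Prop := exists2 a, a \in I & a != 0.

Definition smul_pred (I : ideal) (M : lmodType D) (P : submodClosed M) : pred M :=
  fun x => `[< exists (k : nat) (a : 'I_k -> D) (p : 'I_k -> M),
                 [/\ forall i, a i \in I, forall i, p i \in P
                   & x = \sum_i a i *: p i] >].

Lemma smul_closed (I : ideal) (M : lmodType D) (P : submodClosed M) :
  subsemimod_closed (smul_pred I P).
Proof.
apply: GRing.submod_closed_semi; split=> [|c x y /asboolP[k [a [p [aI pP ->]]]]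
  /asboolP[l [b [q [bI qP ->]]]]].
  apply/asboolP; exists 0%N, (fun=> 0), (fun=> 0).
  by split=> [[]|[]|] //; rewrite big_ord0.
apply/asboolP; exists (k + l)%N,
  (fun i => match split i with inl i => c * a i | inr j => b j end),
  (fun i => match split i with inl i => p i | inr j => q j end).
split=> [i|i|].
- by case: (split i) => j //; exact: (@rpredZ D D^o I c _ (aI j)).
- by case: (split i).
rewrite big_split_ord scaler_sumr; congr (_ + _); apply: eq_bigr => i _.
  by rewrite (unsplitK (inl i)) scalerA.
by rewrite (unsplitK (inr i)).
Qed.

HB.instance Definition _ (I : ideal) (M : lmodType D) (P : submodClosed M) :=
  GRing.isSubmodClosed.Build D M (smul_pred I P) (smul_closed I P).

(* The product I P: finite sums of products a p with a in I and p in P. *)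
Definition smul (I : ideal) (M : lmodType D) (P : submodClosed M) :
  submodClosed M := GRing.SubmodClosed.clone D M (smul_pred I P) _.

(* N is the internal direct sum of the submodules Q j. *)
Definition internal_dsum (M : lmodType D) (N : {pred M}) (n : nat)
    (Q : 'I_n -> submodClosed M) : Prop :=
  (forall j, {subset Q j <= N}) /\
  forall x, x \in N ->
    exists! y : {ffun 'I_n -> M}, (forall j, y j \in Q j) /\ x = \sum_j y j.

Definition stacked_bases_property : Prop :=
  forall (M : lmodType D) (m : nat), free_of_rank M m ->
  forall (N : submodClosed M) (n : nat) (le_nm : (n <= m)%N),
    fin_gen (submod_of N) -> has_rank (submod_of N) n ->
  exists (P : 'I_m -> submodClosed M) (I : 'I_n -> ideal),
    [/\ forall j, projective (submod_of (P j)) /\ has_rank (submod_of (P j)) 1,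
        forall j, nonzero_ideal (I j),
        internal_dsum predT P,
        internal_dsum N (fun j => smul (I j) (P (widen_ord le_nm j)))
      & forall j k : 'I_n, k = j.+1 :> nat -> {subset I k <= I j}].

(* The fraction field of D as a D-module, so that fractional ideals are
   submodules of it. *)
Definition frac_mod : Type := {fraction D}.
HB.instance Definition _ := GRing.Zmodule.on frac_mod.

Definition frac_scale (a : D) (x : frac_mod) : frac_mod :=
  tofrac a * x.

Fact frac_scaleA a b x : frac_scale a (frac_scale b x) = frac_scale (a * b) x.
Proof. by rewrite /frac_scale tofracM mulrA. Qed.
Fact frac_scale1 : left_id 1 frac_scale.
Proof. by move=> x; rewrite /frac_scale tofrac1 mul1r. Qed.
Fact frac_scaleDr : right_distributive frac_scale +%R.
Proof. by move=> a x y; rewrite /frac_scale mulrDr. Qed.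
Fact frac_scaleDl x : {morph frac_scale^~ x : a b / a + b}.
Proof. by move=> a b; rewrite /frac_scale tofracD mulrDl. Qed.
HB.instance Definition _ := GRing.Zmodule_isLmodule.Build D frac_mod
  frac_scaleA frac_scale1 frac_scaleDr frac_scaleDl.

Definition fractional (J : submodClosed frac_mod) : Prop :=
  exists2 d : D, d != 0 &
    forall x, x \in J -> exists a : D, d *: x = tofrac a.

(* I J = D for some fractional ideal J. *)
Definition invertible_ideal (I : ideal) : Prop :=
  exists J : submodClosed frac_mod, fractional J /\
    forall x : frac_mod, x \in smul I J <-> exists a : D, x = tofrac a.

Definition prufer_domain : Prop :=
  forall I : ideal, fin_gen (submod_of I) -> nonzero_ideal I -> invertible_ideal I.

End Modules.

(* Valuations with value group in (R, +); v 0 = +oo. *)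
Record real_valuation (K : fieldType) (R : realType) := RealValuation {
  vfun :> K -> \bar R;
  vfun0 : vfun 0 = +oo%E;
  vfun_fin : forall x, x != 0 -> vfun x \is a fin_num;
  vfunM : forall x y, vfun (x * y) = (vfun x + vfun y)%E;
  vfunD : forall x y, (Order.min (vfun x) (vfun y) <= vfun (x + y))%E }.

(* v (K^* ) is automatically a subgroup of R; rank one means it is nonzero. *)
Definition rank_one (K : fieldType) (R : realType) (v : real_valuation K R) : Prop :=
  exists2 x : K, x != 0 & v x != 0%E.

Section ValuationDomain.
Variables (K : fieldType) (R : realType) (v : real_valuation K R).

Definition valuation_pred : pred K := fun x => (0 <= v x)%E.

Lemma vfun1 : v 1 = 0%E.
Proof.
have /fineK h := vfun_fin v (oner_neq0 K).
have := vfunM v 1 1; rewrite mulr1 -h -EFinD => -[] /eqP.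
by rewrite -[X in X == _]addr0 (inj_eq (addrI _)) => /eqP <-.
Qed.

Lemma vfunN1 : v (-1) = 0%E.
Proof.
have /fineK h : v (-1) \is a fin_num by apply: vfun_fin; rewrite oppr_eq0 oner_neq0.
have := vfunM v (-1) (-1); rewrite mulrNN mulr1 vfun1 -h -EFinD => -[] /esym/eqP.
by rewrite -mulr2n mulrn_eq0 /= => /eqP ->.
Qed.

Lemma valuation_closed : subring_closed valuation_pred.
Proof.
split; rewrite /valuation_pred.
- by rewrite unfold_in vfun1.
- move=> x y; rewrite !unfold_in => x0 y0; apply: le_trans (vfunD v x (- y)).
  by rewrite le_min x0 -mulN1r vfunM vfunN1 add0e.
- by move=> x y; rewrite !unfold_in vfunM => x0 y0; rewrite adde_ge0.
Qed.

HB.instance Definition _ :=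
  GRing.isSubringClosed.Build K valuation_pred valuation_closed.

Definition valuation_domain : subringClosed K :=
  GRing.SubringClosed.clone K valuation_pred _.

End ValuationDomain.

Section IntegerValued.
Variables (K : fieldType) (E : set K) (V : subringClosed K).

Definition int_valued_pred : pred {poly K} :=
  fun f => `[< forall x, E x -> f.[x] \in V >].

Lemma int_valued_closed : subring_closed int_valued_pred.
Proof.
split=> [|f g /asboolP fV /asboolP gV|f g /asboolP fV /asboolP gV];
  apply/asboolP => x Ex.
- by rewrite hornerC rpred1.
- by rewrite hornerD hornerN rpredB ?fV ?gV.
- by rewrite hornerM rpredM ?fV ?gV.
Qed.

HB.instance Definition _ :=
  GRing.isSubringClosed.Build {poly K} int_valued_pred int_valued_closed.

(* The ring Int(E, V). *)
Record int_valued := IntValued {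
  int_valued_poly :> {poly K};
  int_valuedP : int_valued_poly \in int_valued_pred }.

HB.instance Definition _ := [isSub for int_valued_poly].
HB.instance Definition _ := [Choice of int_valued by <:].
HB.instance Definition _ := [SubChoice_isSubComNzRing of int_valued by <:].

Definition int_valued_unit : {pred int_valued} :=
  fun f => `[< exists g, g * f = 1 >].

Definition int_valued_inv (f : int_valued) : int_valued :=
  if pselect (exists g, g * f = 1) is left e then sval (cid e) else f.

Fact int_valued_mulVf : {in int_valued_unit, left_inverse 1 int_valued_inv *%R}.
Proof.
move=> f /asboolP uf; rewrite /int_valued_inv; case: pselect => // e.
exact: svalP (cid e).
Qed.

Fact int_valued_unitP (f g : int_valued) : g * f = 1 -> int_valued_unit f.
Proof. by move=> gf; apply/asboolP; exists g. Qed.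

Fact int_valued_inv_out : {in [predC int_valued_unit], int_valued_inv =1 id}.
Proof.
move=> f /asboolPn nuf; rewrite /int_valued_inv.
by case: pselect.
Qed.

HB.instance Definition _ := GRing.ComNzRing_hasMulInverse.Build int_valued
  int_valued_mulVf int_valued_unitP int_valued_inv_out.

Fact int_valued_domain (f g : int_valued) : f * g = 0 -> (f == 0) || (g == 0).
Proof.
by move/(congr1 val)/eqP; rewrite rmorphM rmorph0 mulf_eq0 -!(inj_eq val_inj) rmorph0.
Qed.

HB.instance Definition _ :=
  GRing.ComUnitRing_isIntegral.Build int_valued int_valued_domain.

End IntegerValued.

(* Main.v *)
Require Import Defs.
From mathcomp Require Import all_boot all_order all_algebra.
From mathcomp Require Import boolp classical_sets constructive_ereal reals.
From HB Require Import structures.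
From mathcomp Require Import generic_quotient ring.
(** Write [D = Int(E, V)], let [m] be the maximal ideal of [V], and suppose that
    [D] is Pruefer.

    Stacked bases reduce to one assertion about matrices: if the entries of [B]
    generate the unit ideal, then the row space of [B] contains a submodule of
    rank one whose content is still the unit ideal ([unit_content_summands]).
    Such a submodule is a direct summand, because a matrix [C] whose 2x2 minors
    vanish and with [\sum c_ij C_ij = 1] satisfies [C (c^T C) = C], so that
    [c^T C] is an idempotent.  Given [N] inside a free module, invertibility of
    the content [I] of [N] allows one to apply this to [I^-1 N], which yields a
    rank-one projective summand [P] with [I P] a summand of [N]; one then splits
    off [P] and [I P] and repeats.  The contents decrease, and once [N] is
    exhausted the same step applied to the remaining summand itself decomposes
    it into rank-one projectives ([stacked_matrices]).

    For the assertion about matrices, two kinds of primes of [D] matter.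

    Primes containing a nonzero constant.  An ideal containing a nonzero
    constant and, for each [x] in [E], some [f] with [f(x)] a unit of [V], is
    [D] ([unit_ideal_of_constant]).  So one wants a combination of the rows of
    [B] that does not vanish mod [m] at any point of [E].  This is elementary
    once every [f] in [D] is known to take finitely many values mod [m] on [E]
    ([finite_residues]): indicator-like functions, such as products of
    [f - f(x_i)], then belong to [D] and glue local choices.

    Finiteness of residues is where the Pruefer hypothesis is used most
    seriously.  If [f] takes infinitely many residues, a tree argument in the
    ultrametric space [E] finds either long pseudo-convergent chains on which
    the residues of [f] are pairwise distinct, or arbitrarily long
    pseudo-divergent chains starting at a fixed point.  The former are ruled out
    by repeated division: a polynomial of degree [d] with values in [V] takes
    twice the same residue on a pseudo-convergent chain of length [d + 2].  The
    latter contradict the invertibility of an ideal [(X - x0, c t)] with [t] in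
    [m]: it provides a polynomial equal to [1] at [x0] and with values in [m] at
    the rest of the chains, whereas division again shows that a polynomial with
    values in [m] along a long enough chain has its value at [x0] in [m].

    Primes not containing a nonzero constant are those of [K[X]].  When some 2x2
    minor of [B] is nonzero, adding generic constants of [m] to the coefficients
    of the combination makes it unimodular over [K[X]] without changing it mod
    [m] on [E] ([generic_combination]), and then the combination is unimodular
    over [D].  When all 2x2 minors vanish, [B] itself will do. *)
Set Implicit Arguments. Unset Strict Implicit. Unset Printing Implicit Defensive.
Import Order.TTheory GRing.Theory Num.Theory.
Local Open Scope ring_scope.

(** * Finitely generated ideals and local principality *)

Section GeneratedIdeal.
Variables (D : idomainType) (T : finType) (b : T -> D).

Definition ideal_gen_pred : pred D^o :=
  fun x => `[< exists c : T -> D, x = \sum_i c i * b i >].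

Lemma ideal_gen_closed : subsemimod_closed ideal_gen_pred.
Proof.
apply: GRing.submod_closed_semi; split=> [|a x y /asboolP[c ->] /asboolP[d ->]].
  by apply/asboolP; exists (fun=> 0); rewrite big1 // => i _; rewrite mul0r.
apply/asboolP; exists (fun i => a * c i + d i).
rewrite scaler_sumr -big_split; apply: eq_bigr => i _ /=.
by rewrite mulrDl -mulrA.
Qed.

HB.instance Definition _ :=
  GRing.isSubmodClosed.Build D D^o ideal_gen_pred ideal_gen_closed.

Definition ideal_gen : ideal D :=
  GRing.SubmodClosed.clone D D^o ideal_gen_pred _.

Lemma ideal_genP x :
  reflect (exists c : T -> D, x = \sum_i c i * b i) (x \in ideal_gen).
Proof. exact: asboolP. Qed.

Lemma mem_ideal_gen i : b i \in ideal_gen.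
Proof.
apply/ideal_genP; exists (fun j => (j == i)%:R).
rewrite (bigD1 i) //= eqxx mul1r big1 ?addr0 // => j /negPf ->.
by rewrite mul0r.
Qed.

Lemma ideal_gen_sub (J : ideal D) :
  (forall i, b i \in J) -> {subset ideal_gen <= J}.
Proof.
move=> bJ x /ideal_genP[c ->]; apply: rpred_sum => i _.
exact: (@rpredZ D D^o J (c i) _ (bJ i)).
Qed.

Lemma ideal_gen_fin_gen : fin_gen (submod_of ideal_gen).
Proof.
exists #|T|, (fun i => SubmodOf (mem_ideal_gen (enum_val i))) => x.
have /ideal_genP[c xE] := submod_valP x.
exists (c \o enum_val); apply: val_inj; rewrite raddf_sum [LHS]xE.
rewrite (reindex (@enum_val T predT)) /=; last exact/onW_bij/enum_val_bij.
by apply: eq_bigr => i _.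
Qed.

End GeneratedIdeal.

Lemma tofrac_inj (D : idomainType) : injective (@tofrac D).
Proof. by move=> x y /eqP; rewrite tofrac_eq => /eqP. Qed.

(** The matrix form of invertibility of the ideal [I] generated by [b]: there
    are [g_i] in [I^-1] with [\sum_i g_i b_i = 1], and [h i j] stands for
    [g_i b_j], which lies in [D].  This avoids computing in the fraction
    field. *)
Definition locally_principal (D : idomainType) : Prop :=
  forall (T : finType) (b : T -> D), (exists i, b i != 0) ->
  exists h : T -> T -> D, \sum_i h i i = 1 /\
    forall i j k, h i j * b k = h i k * b j.

Lemma prufer_locally_principal (D : idomainType) :
  prufer_domain D -> locally_principal D.
Proof.
move=> DP T b [i0 bi0].
have [||J [_ IJ]] := DP (ideal_gen b).
- exact: ideal_gen_fin_gen.
- by exists (b i0) => //; exact: mem_ideal_gen.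
have bJ i g : g \in J -> exists a : D, b i *: g = tofrac a.
  move=> gJ; apply/IJ/asboolP; exists 1, (fun=> b i), (fun=> g).
  by split=> [_|_|] //; [exact: mem_ideal_gen | rewrite big_ord1].
have /asboolP[n [a [p [aI pJ oneE]]]] :
    (tofrac 1 : frac_mod D) \in smul (ideal_gen b) J.
  by apply/IJ; exists 1.
have /boolp.choice[c cE] l : exists c : T -> D, a l = \sum_i c i * b i.
  exact/ideal_genP/aI.
pose g i := \sum_l c l i *: p l.
have gJ i : g i \in J by apply: rpred_sum => l _; apply: rpredZ.
have /boolp.choice[h hE] (ij : T * T) : exists a : D, b ij.2 *: g ij.1 = tofrac a.
  exact: bJ.
exists (fun i j => h (i, j)); split.
  apply: tofrac_inj; rewrite oneE rmorph_sum /=.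
  under eq_bigr do rewrite -hE /= /g scaler_sumr.
  rewrite exchange_big; apply: eq_bigr => l _; rewrite cE scaler_suml.
  by apply: eq_bigr => i _; rewrite scalerA mulrC.
move=> i j k; apply: tofrac_inj; rewrite !tofracM -!hE /=.
by rewrite /GRing.scale /= /frac_scale; ring.
Qed.

(** * Matrices of unit content *)

Section UnitContent.
Variables (D : idomainType) (k m : nat).
Implicit Types B : 'M[D]_(k, m).

Definition unit_content B : Prop :=
  exists c : 'M[D]_(k, m), \sum_i \sum_j c i j * B i j = 1.

Definition minors_vanish B : Prop :=
  forall i1 i2 j1 j2, B i1 j1 * B i2 j2 = B i1 j2 * B i2 j1.

End UnitContent.

(** The row space of [U *m B] has rank one and, having unit content, is a direct
    summand of the free module: see [idempotent_of_minors]. *)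
Definition unit_content_summands (D : idomainType) : Prop :=
  forall k m (B : 'M[D]_(k, m)), unit_content B ->
  exists k' (U : 'M[D]_(k', k)), unit_content (U *m B) /\ minors_vanish (U *m B).

(** * Polynomials on chains of an ultrametric space *)

Section Valuation.
Variables (K : fieldType) (R : realType) (v : real_valuation K R).

Lemma val_fin x : x != 0 -> exists r : R, v x = r%:E.
Proof. by move=> /(vfun_fin v)/fineK <-; exists (fine (v x)). Qed.

Lemma valN x : v (- x) = v x.
Proof. by rewrite -mulN1r vfunM vfunN1 add0e. Qed.

Lemma val_subC x y : v (x - y) = v (y - x).
Proof. by rewrite -valN opprB. Qed.

Lemma val_geD (a : \bar R) x y : (a <= v x -> a <= v y -> a <= v (x + y))%O.
Proof. by move=> ax ay; apply: le_trans (vfunD v x y); rewrite le_min ax. Qed.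

Lemma val_gtD (a : \bar R) x y : (a < v x -> a < v y -> a < v (x + y))%O.
Proof. by move=> ax ay; apply: lt_le_trans (vfunD v x y); rewrite lt_min ax. Qed.

Lemma val_gtB (a : \bar R) x y : (a < v x -> a < v y -> a < v (x - y))%O.
Proof. by move=> ax ay; apply: val_gtD => //; rewrite valN. Qed.

Lemma val_geB (a : \bar R) x y : (a <= v x -> a <= v y -> a <= v (x - y))%O.
Proof. by move=> ax ay; apply: val_geD => //; rewrite valN. Qed.

Lemma val_mul_gt0l x y : (0%E < v x -> 0%E <= v y -> 0%E < v (x * y))%O.
Proof. by move=> x0 y0; rewrite vfunM lte_paddr. Qed.

Lemma val_mul_gt0r x y : (0%E <= v x -> 0%E < v y -> 0%E < v (x * y))%O.
Proof. by move=> x0 y0; rewrite mulrC; apply: val_mul_gt0l. Qed.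

Lemma val_mul_ge0 x y : (0%E <= v x -> 0%E <= v y -> 0%E <= v (x * y))%O.
Proof. by move=> x0 y0; rewrite vfunM adde_ge0. Qed.

Lemma val_mul_eq a b c : v a = v b -> v (a * c) = v (b * c).
Proof. by move=> ab; rewrite !vfunM ab. Qed.

Lemma val_div_ge0 a x : a != 0 -> (0%E <= v (x / a))%O = (v a <= v x)%O.
Proof.
move=> a0; have [->|x0] := eqVneq x 0; first by rewrite mul0r vfun0 !leey.
rewrite -{2}(divfK a0 x).
have /val_fin[r er] : x / a != 0 by rewrite mulf_neq0 ?invr_eq0.
have [s es] := val_fin a0.
by rewrite (vfunM v (x / a) a) er es -EFinD !lee_fin lerDr.
Qed.

Lemma val_div_gt0 a x : a != 0 -> (0%E < v (x / a))%O = (v a < v x)%O.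
Proof.
move=> a0; have [->|x0] := eqVneq x 0.
  by rewrite mul0r vfun0; have [s ->] := val_fin a0; rewrite !ltey.
rewrite -{2}(divfK a0 x).
have /val_fin[r er] : x / a != 0 by rewrite mulf_neq0 ?invr_eq0.
have [s es] := val_fin a0.
by rewrite (vfunM v (x / a) a) er es -EFinD !lte_fin ltrDr.
Qed.

Lemma val_eqDl x y : (v x < v y)%O -> v (x + y) = v x.
Proof.
move=> xy; apply/le_anti/andP; split.
  rewrite leNgt; apply/negP => h.
  have := val_gtB h xy; rewrite addrK ltxx //.
by apply: val_geD => //; apply: ltW.
Qed.

Lemma val_eq0 a : (0%E <= v a)%O -> ~~ (0%E < v a)%O -> v a = 0%E.
Proof. by rewrite le_eqVlt => /orP[/eqP ->|->]. Qed.

Lemma val_prod_eq0 (T : eqType) (s : seq T) (F : T -> K) :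
  (forall i, i \in s -> v (F i) = 0%E) -> v (\prod_(i <- s) F i) = 0%E.
Proof.
move=> F0; rewrite big_seq; apply: (big_ind (fun a => v a = 0%E)) => //.
  exact: vfun1.
by move=> a b va vb; rewrite vfunM va vb adde0.
Qed.

Lemma val_prod_ge0 (T : eqType) (s : seq T) (F : T -> K) :
  (forall i, i \in s -> (0%E <= v (F i))%O) -> (0%E <= v (\prod_(i <- s) F i))%O.
Proof.
move=> F0; rewrite big_seq; apply: (big_ind (fun a => 0%E <= v a)%O) => //.
  by rewrite vfun1.
by move=> a b; apply: val_mul_ge0.
Qed.

(** Finite pseudo-convergent sequences in the sense of Ostrowski, with the
    strictly increasing distances [v a]. *)
Fixpoint pseudo_convergent (s : seq K) : Prop :=
  if s is z :: s' then
    (exists a, [/\ a != 0, forall y, y \in s' -> v (y - z) = v a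
      & forall y y', y \in s' -> y' \in s' -> (v a < v (y - y'))%O])
    /\ pseudo_convergent s'
  else True.

Lemma div_factor (f : {poly K}) z n : (size f <= n.+1)%N ->
  exists g : {poly K}, (size g <= n)%N /\ f = (f.[z])%:P + ('X - z%:P) * g.
Proof.
move=> sf; exists ((f - (f.[z])%:P) %/ ('X - z%:P)).
have dv : 'X - z%:P %| f - (f.[z])%:P.
  by rewrite dvdp_XsubCl /root !hornerE subrr.
split; last by rewrite mulrC divpK // addrC subrK.
rewrite size_divp ?polyXsubC_eq0 // size_XsubC subn1 -subn1 leq_subLR add1n.
apply: leq_trans (size_polyD _ _) _; rewrite size_polyN geq_max sf.
by apply: leq_trans (size_polyC_leq1 _) _.
Qed.

(** Interpolation on the chain would give the value at the last point in terms
    of the others with weights in the maximal ideal but for one weight congruent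
    to 1.  The induction divides by the first point [z] instead: on the later
    points [g = (f - f(z)) / (X - z)] is integral up to the constant factor [a],
    since the denominators [y - z] all have the valuation of [a]. *)
Lemma pseudo_convergent_congr d (s : seq K) (f : {poly K}) :
  pseudo_convergent s -> size s = d.+2 -> (size f <= d.+1)%N ->
  (forall y, y \in s -> 0%E <= v f.[y])%O ->
  exists y y', [/\ y \in s, y' \in s, y != y' & (0%E < v (f.[y] - f.[y']))%O].
Proof.
elim: d s f => [|d IHd] [//|z s] f [[a [a0 va vaa] pcs] [ss] sf fs].
  case: s ss va {vaa pcs fs} => [//|y s] _ va.
  exists y, z; rewrite !inE !eqxx orbT; split=> //.
    by apply: contraNneq (a0) => yz; have := va y (mem_head _ _);
       rewrite yz subrr vfun0; have [r ->] := val_fin a0.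
  by rewrite (size1_polyC sf) !hornerC subrr vfun0 ltey.
have [g [sg fE]] := div_factor z sf.
have fyE y : f.[y] = f.[z] + (y - z) * g.[y] by rewrite {1}fE !hornerE.
have ag y : y \in s -> (0%E <= v (a * g.[y]))%O.
  move=> ys; rewrite -(val_mul_eq _ (va y ys)).
  have -> : (y - z) * g.[y] = f.[y] - f.[z] by rewrite fyE [RHS]addrC addKr.
  by apply: val_geB; apply: fs; rewrite inE ?ys ?orbT ?eqxx.
have [||y [y' [ys y's yy' h]]] := IHd s (a *: g) pcs ss.
- exact: leq_trans (size_scale_leq _ _) sg.
- by move=> y ys; rewrite hornerZ ag.
exists y, y'; rewrite !inE ys y's !orbT; split=> //.
(* In the first term y - z can be replaced by a; in the second, y - y' is
   strictly smaller than a. *)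
have -> : f.[y] - f.[y'] =
    (y - z) * (g.[y] - g.[y']) + ((y - y') / a) * (a * g.[y']).
  rewrite [f.[y]]fyE [f.[y']]fyE; field; exact: a0.
apply: val_gtD.
  by rewrite (val_mul_eq _ (va y ys)); move: h; rewrite !hornerZ -mulrBr.
by apply: val_mul_gt0l; rewrite ?ag // val_div_gt0 // vaa.
Qed.

(** The chain recedes from [x0], and is listed from its far end: division by
    [X - z] for the head [z] is then controlled by the single constant [a]. *)
Fixpoint pseudo_divergent (x0 : K) (s : seq K) : Prop :=
  if s is z :: s' then
    (exists a, a != 0 /\ forall y, y \in x0 :: s' -> v (y - z) = v a)
    /\ pseudo_divergent x0 s'
  else True.

Lemma pseudo_divergent_pos x0 s (g : {poly K}) :
  pseudo_divergent x0 s -> (size g <= size s)%N ->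
  (forall y, y \in s -> 0%E < v g.[y])%O -> (0%E < v g.[x0])%O.
Proof.
elim: s g => [|z s IHs] g /=.
  by move=> _; rewrite leqn0 size_poly_eq0 => /eqP -> _; rewrite horner0 vfun0 ltey.
move=> [[a [a0 va]] pds] sg gs.
have [h [sh gE]] := div_factor z sg.
have gyE y : g.[y] = g.[z] + (y - z) * h.[y] by rewrite {1}gE !hornerE.
have ah : (0%E < v (a *: h).[x0])%O.
  apply: IHs => // [|y ys]; first exact: leq_trans (size_scale_leq _ _) sh.
  rewrite hornerZ -(val_mul_eq _ (va y _)) ?inE ?ys ?orbT //.
  have -> : (y - z) * h.[y] = g.[y] - g.[z] by rewrite gyE [RHS]addrC addKr.
  by apply: val_gtB; apply: gs; rewrite inE ?ys ?orbT ?eqxx.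
rewrite gyE; apply: val_gtD; first by rewrite gs ?inE ?eqxx.
by rewrite (val_mul_eq _ (va x0 (mem_head _ _))) -hornerZ.
Qed.

End Valuation.

(** * Finiteness of residues of integer-valued polynomials *)

Section IntValued.
Variables (K : fieldType) (R : realType) (v : real_valuation K R).

(** This smallness of [S] relative to [f] replaces finiteness: the chains have to
    keep the residues of [f] distinct, and the sets on which [f] has finitely
    many residues form an ideal of sets. *)
Definition finite_mod (f : {poly K}) (S : K -> Prop) : Prop :=
  exists r : seq K, forall x, S x -> exists2 c, c \in r & (0%E < v (f.[x] - c))%O.

Lemma finite_mod_sub f (S S' : K -> Prop) :
  (forall x, S x -> S' x) -> finite_mod f S' -> finite_mod f S.
Proof. by move=> SS' [r rP]; exists r => x /SS'/rP. Qed.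

Lemma finite_modU f (S S' : K -> Prop) :
  finite_mod f S -> finite_mod f S' -> finite_mod f (fun x => S x \/ S' x).
Proof.
move=> [r rP] [r' rP']; exists (r ++ r') => x [/rP|/rP'] [c cr h];
  by exists c; rewrite // mem_cat cr ?orbT.
Qed.

Lemma finite_mod1 f y : finite_mod f (fun x => x = y).
Proof. by exists [:: f.[y]] => x ->; exists f.[y]; rewrite ?inE // subrr vfun0 ltey. Qed.

Lemma finite_mod_bigU f (T : eqType) (l : seq T) (F : T -> K -> Prop) :
  (forall i, i \in l -> finite_mod f (F i)) ->
  finite_mod f (fun x => exists2 i, i \in l & F i x).
Proof.
elim: l => [|i l IHl] Fl; first by exists [::] => x [i].
apply: (@finite_mod_sub _ _ (fun x => F i x \/ exists2 i, i \in l & F i x)).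
  move=> x [j]; rewrite inE => /orP[/eqP ->|jl]; first by left.
  by right; exists j.
apply: finite_modU; first by apply: Fl; rewrite mem_head.
by apply: IHl => j jl; apply: Fl; rewrite inE jl orbT.
Qed.

(** The bound [v c] is independent of the length of the chain, so that a single
    ideal [(X - x0, c t)] can be played against chains of every length. *)
Definition long_divergent (S : K -> Prop) : Prop :=
  exists x0 c, [/\ S x0, c != 0 & forall n, exists s,
    [/\ size s = n, pseudo_divergent v x0 s
      & forall y, y \in s -> S y /\ (v (y - x0) <= v c)%O]].

Lemma not_finite_mod_nonempty f (S : K -> Prop) : ~ finite_mod f S -> exists x, S x.
Proof.
by move=> nS; apply: contra_notP nS => nS; exists [::] => x Sx; case: nS; exists x.
Qed.

Lemma not_finite_mod_setD f (S S' : K -> Prop) :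
  ~ finite_mod f S -> finite_mod f S' -> ~ finite_mod f (fun x => S x /\ ~ S' x).
Proof.
move=> nS sS' sD; apply: nS; apply: finite_mod_sub (finite_modU sS' sD) => x Sx.
by have [S'x|nS'x] := pselect (S' x); [left | right].
Qed.

(** If all the balls spanned by two points of [S] are small, a point [w] outside
    the finitely many balls attached to a chain is equidistant from all its
    points, by the ultrametric inequality; it can be put in front of the
    chain. *)
Lemma long_divergent_exists f (S : K -> Prop) :
  ~ finite_mod f S ->
  (forall y z, S y -> S z -> y != z ->
     finite_mod f (fun w => S w /\ (v (z - y) < v (w - y))%O)) ->
  long_divergent S.
Proof.
move=> nS sS.
have ext (l : seq K) : (forall y, y \in l -> S y) -> exists w, [/\ S w, w \notin l
    & forall y z, y \in l -> z \in l -> y != z -> (v (w - y) <= v (z - y))%O].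
  move=> lS.
  (* The diagonal pairs (y, y) contribute the points of l themselves. *)
  pose F (p : K * K) w := w = p.1 \/
    (p.1 != p.2 /\ (S w /\ (v (p.2 - p.1) < v (w - p.1))%O)).
  have /not_finite_mod_nonempty[w [Sw nF]] : ~ finite_mod f (fun w => S w /\
      ~ exists2 p, p \in [seq (y, z) | y <- l, z <- l] & F p w).
    apply: not_finite_mod_setD => //; apply: finite_mod_bigU => p.
    move=> /allpairsP[[y z] /= [yl zl ->]].
    apply: finite_modU; first exact: finite_mod1.
    have [->|yz] := eqVneq y z.
      by exists [::] => x [].
    by apply: finite_mod_sub (sS y z (lS y yl) (lS z zl) yz) => x [].
  exists w; split=> // [|y z yl zl yz].
    apply/negP => wl; apply: nF; exists (w, w); last by left.
    by apply/allpairsP; exists (w, w).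
  rewrite leNgt; apply/negP => h; apply: nF; exists (y, z); last by right.
  by apply/allpairsP; exists (y, z).
have [x0 Sx0] := not_finite_mod_nonempty nS.
have [|x1 [Sx1 x10 _]] := ext [:: x0]; first by move=> y; rewrite inE => /eqP ->.
rewrite inE in x10.
exists x0, (x1 - x0); split=> //; first by rewrite subr_eq0.
elim=> [|n [s [sn pds sS']]]; first by exists [::].
have [|w [Sw wl wP]] := ext [:: x0, x1 & s].
  by move=> y; rewrite !inE => /or3P[/eqP ->|/eqP ->|/sS'[]].
have wneq y : y \in [:: x0, x1 & s] -> w != y by apply: contraTneq => <-.
have sub y : y \in x0 :: s -> y \in [:: x0, x1 & s].
  by rewrite !inE => /orP[->|->]; rewrite ?orbT.
exists (w :: s); split; rewrite /= ?sn //.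
  split=> //; exists (w - x0); split.
    by rewrite subr_eq0 wneq // inE eqxx.
  move=> y ys; rewrite val_subC.
  have [->//|yx0] := eqVneq y x0.
  have x0s : x0 \in [:: x0, x1 & s] by rewrite inE eqxx.
  have h1 := wP y x0 (sub y ys) x0s yx0.
  have h2 : (v (w - x0) <= v (y - x0))%O by apply: wP => //; [exact: sub | rewrite eq_sym].
  apply/le_anti/andP; split.
    have -> : w - x0 = (w - y) - (x0 - y) by ring.
    exact: val_geB.
  have -> : w - y = (w - x0) - (y - x0) by ring.
  exact: val_geB.
move=> y; rewrite inE => /orP[/eqP ->|/sS'//]; split=> //.
by apply: wP; rewrite ?inE ?eqxx ?orbT // eq_sym.
Qed.

(** By the previous lemma some ball, spanned by [z] and [y] and centered at [y],
    is not small: it lies at constant distance from [z], and the construction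
    continues inside it after removal of the points where [f] is congruent to
    [f(z)]. *)
Lemma pseudo_convergent_exists f n (S : K -> Prop) :
  ~ finite_mod f S -> ~ long_divergent S ->
  exists s, [/\ size s = n, pseudo_convergent v s, forall y, y \in s -> S y
    & forall y y', y \in s -> y' \in s -> y != y' -> ~ (0%E < v (f.[y] - f.[y']))%O].
Proof.
elim: n S => [|n IHn] S nS nD; first by exists [::].
have [z [y [Sz Sy yz nS']]] : exists z y, [/\ S z, S y, y != z &
    ~ finite_mod f (fun w => S w /\ (v (z - y) < v (w - y))%O)].
  apply: contrapT => h; apply: nD; apply: long_divergent_exists nS _ => y z Sy Sz yz.
  by apply: contrapT => h'; apply: h; exists z, y.
pose cong w := (0%E < v (f.[w] - f.[z]))%O.
have sc : finite_mod f (fun w => is_true (cong w)).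
  by exists [:: f.[z]] => w h; exists f.[z]; rewrite ?mem_head.
have [|s [sn pcs sS fs]] := IHn _ (not_finite_mod_setD nS' sc).
  move=> [x0 [c [[[Sx0 _] _] c0 H]]]; apply: nD; exists x0, c; split=> // k.
  have [s [sk pds sS]] := H k; exists s; split=> // w /sS[[[Sw _] _] ?].
  by split.
exists (z :: s); split; rewrite /= ?sn //.
- split=> //; exists (z - y); split; first by rewrite subr_eq0 eq_sym.
    move=> w /sS[[Sw vw] _]; rewrite val_subC.
    have -> : z - w = (z - y) + (y - w) by ring.
    by apply: val_eqDl; rewrite (val_subC v y w).
  move=> w w' /sS[[_ vw] _] /sS[[_ vw'] _].
  have -> : w - w' = (w - y) - (w' - y) by ring.
  exact: val_gtB.
- by move=> w; rewrite inE => /orP[/eqP ->|/sS[[]]].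
move=> w w'; rewrite !inE => /orP[/eqP ->|ws] /orP[/eqP ->|ws'].
- by rewrite eqxx.
- by move=> _; rewrite val_subC; have [_] := sS _ ws'.
- by move=> _; have [_] := sS _ ws.
exact: fs.
Qed.

Variable E : set K.
Let V := valuation_domain v.
Let D := int_valued E V.

Lemma int_valued_ge0 (f : D) x : E x -> (0%E <= v (int_valued_poly f).[x])%O.
Proof. by move=> Ex; have /asboolP/(_ x Ex) := int_valuedP f. Qed.

Lemma int_valued_ex (p : {poly K}) :
  (forall x, E x -> 0%E <= v p.[x])%O -> exists f : D, int_valued_poly f = p.
Proof.
move=> h; have pP : p \in int_valued_pred E V by apply/asboolP => x /h.
by exists (IntValued pP).
Qed.

Hypothesis lpD : locally_principal D.
Variable t : K.
Hypotheses (t0 : t != 0) (vt : (0%E < v t)%O).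

(** Invertibility of [(X - x0, c t)] gives [g] in [D] with [g(x0) = 1] and
    [g (X - x0)] in [c t D].  As [v (y - x0) <= v c] on the chains, [g] takes
    there values of valuation at least [v t], contrary to
    [pseudo_divergent_pos]. *)
Lemma not_long_divergent : (forall x, E x -> 0%E <= v x)%O -> ~ long_divergent E.
Proof.
move=> EV [x0 [c [Ex0 c0 H]]].
have vc : (0%E <= v c)%O.
  have [[|y s] [s1 _ sE]] := H 1%N; first by [].
  have := sE y; rewrite inE eqxx => /(_ isT)[Ey]; apply: le_trans.
  by apply: val_geB; apply: EV.
have vct : (0%E <= v (c * t))%O by apply: val_mul_ge0 => //; apply: ltW.
have [X XE] : exists f : D, int_valued_poly f = 'X - x0%:P.
  by apply: int_valued_ex => x Ex; rewrite !hornerE; apply: val_geB; apply: EV.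
have [C CE] : exists f : D, int_valued_poly f = (c * t)%:P.
  by apply: int_valued_ex => x Ex; rewrite hornerC.
have [|h [h1 hP]] := lpD (b := fun i : bool => if i then C else X).
  exists true; apply/eqP => /(congr1 (@int_valued_poly _ _ _)).
  by rewrite CE => /eqP; rewrite polyC_eq0 (negPf (mulf_neq0 c0 t0)).
have evD (f g : D) x : (int_valued_poly (f + g)).[x] =
    (int_valued_poly f).[x] + (int_valued_poly g).[x].
  by rewrite -hornerD.
have evM (f g : D) x : (int_valued_poly (f * g)).[x] =
    (int_valued_poly f).[x] * (int_valued_poly g).[x].
  by rewrite -hornerM.
pose e i j x := (int_valued_poly (h i j)).[x].
have e1 x : e true true x + e false false x = 1.
  move: h1; rewrite big_bool => /(congr1 (fun f : D => (int_valued_poly f).[x])).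
  by rewrite evD /= hornerC.
have eX x : e true true x * (x - x0) = e true false x * (c * t).
  have /(congr1 (fun f : D => (int_valued_poly f).[x])) := hP true true false.
  by rewrite !evM XE CE !hornerE.
have eC x : e false false x * (c * t) = e false true x * (x - x0).
  have /(congr1 (fun f : D => (int_valued_poly f).[x])) := hP false false true.
  by rewrite !evM XE CE !hornerE.
have e0 : e true true x0 = 1.
  have := eC x0; rewrite subrr mulr0 => /eqP; rewrite mulf_eq0 (negPf (mulf_neq0 c0 t0)).
  by rewrite orbF => /eqP e00; rewrite -[LHS]addr0 -e00 e1.
have [s [sn pds sE]] := H (size (int_valued_poly (h true true))).
have := pseudo_divergent_pos (g := int_valued_poly (h true true)) pds.
rewrite sn -/(e true true x0) e0 vfun1 ltxx => /(_ (leqnn _))hs; suff: false by [].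
apply: hs => y ys.
have [Ey vy] := sE y ys.
have [yx0|yx0] := eqVneq y x0.
  move: vy; rewrite yx0 subrr vfun0; have [r ->] := val_fin v c0.
  by rewrite leye_eq.
rewrite -subr_eq0 in yx0.
have -> : (int_valued_poly (h true true)).[y] = e true false y * (c / (y - x0)) * t.
  by rewrite -/(e true true y) -(mulfK yx0 (e true true y)) eX; field.
apply: val_mul_gt0r => //; apply: val_mul_ge0; first exact: int_valued_ge0.
by rewrite val_div_ge0.
Qed.

Lemma finite_residues (f : D) : (forall x, E x -> 0%E <= v x)%O -> finite_mod f E.
Proof.
move=> EV; apply: contrapT => nE.
have [s [sn pcs sE fs]] :=
  pseudo_convergent_exists (size (int_valued_poly f)).+2 nE (not_long_divergent EV).
have [||y [y' [ys y's yy']]] := pseudo_convergent_congr (f := f) pcs sn.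
- exact: leqnSn.
- by move=> y /sE; apply: int_valued_ge0.
exact: fs.
Qed.

End IntValued.

(** * Unimodular combinations over K[X] *)

Section Pencil.
Variables (K : fieldType).

Definition coprime_family (F : {poly K} -> Prop) : Prop :=
  forall d, (forall q, F q -> d %| q) -> d %= 1.

(** For distinct constants [a], common divisors of [F] and of the [w + a r] are
    pairwise coprime: a common factor of two of them divides [(a - b) r], hence
    [r], hence [w].  They all divide [c], so fewer than [size c] of them are not
    constant. *)
Lemma coprime_pencil (T : Type) (F : {poly K} -> Prop) (c : {poly K})
    (w r : T -> {poly K}) (s : seq K) :
  F c -> c != 0 ->
  coprime_family (fun q => F q \/ exists j, q = w j \/ q = r j) ->
  uniq s -> (size c <= size s)%N ->
  exists2 a, a \in s & coprime_family (fun q => F q \/ exists j, q = w j + a *: r j).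
Proof.
move=> Fc c0 cop us sc; apply: contrapT => nex.
have /boolp.choice[dd ddP] a : exists d, a \in s ->
    (forall q, (F q \/ exists j, q = w j + a *: r j) -> d %| q) /\ ~~ (d %= 1).
  apply: contrapT => nd; apply: nex; exists a.
    by apply: contrapT => /negP/negPf as_; apply: nd; exists 0; rewrite as_.
  move=> d dP; apply: contrapT => /negP d1; apply: nd; exists d; split=> //.
have dd_c a : a \in s -> dd a %| c.
  by move=> /ddP[dP _]; apply: dP; left.
have cop_dd a b : a \in s -> b \in s -> a != b -> coprimep (dd a) (dd b).
  move=> /ddP[da _] /ddP[db _] ab; apply/coprimepP => e ea eb.
  have ew j : e %| r j.
    have ab0 : a - b != 0 by rewrite subr_eq0.
    rewrite -(dvdpZr _ _ ab0).
    have -> : (a - b) *: r j = (w j + a *: r j) - (w j + b *: r j).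
      by rewrite scalerBl opprD addrACA subrr add0r.
    by apply: dvdp_sub; [apply: dvdp_trans ea _; apply: da
      | apply: dvdp_trans eb _; apply: db]; right; exists j.
  apply: cop => q [Fq|[j [->|->]]] //; first by rewrite (dvdp_trans ea) ?da //; left.
  rewrite -(addrK (a *: r j) (w j)); apply: dvdp_sub; last by rewrite -mul_polyC dvdp_mull.
  by apply: dvdp_trans ea _; apply: da; right; exists j.
suff main l : uniq l -> {subset l <= s} ->
    \prod_(a <- l) dd a %| c /\ (size l < size (\prod_(a <- l) dd a)%R)%N.
  have [dvd sz] := main s us (fun _ => id).
  by have := leq_trans (leq_trans sz (dvdp_leq c0 dvd)) sc; rewrite ltnn.
elim: l => [|a l IHl] /=; first by rewrite big_nil dvd1p size_poly1.
move=> /andP[al ul] ls; rewrite big_cons.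
have ls' : {subset l <= s} by move=> b bl; apply: ls; rewrite inE bl orbT.
have [dvd sz] := IHl ul ls'.
have as_ : a \in s by apply: ls; rewrite mem_head.
have [_ d1] := ddP a as_.
have copl : coprimep (dd a) (\prod_(b <- l) dd b).
  rewrite big_seq; apply: (big_ind (coprimep (dd a))) => [|x y|b bl].
  - exact: coprimep1.
  - by rewrite coprimepMr => -> ->.
  - apply: cop_dd => //; first exact: ls'.
    by apply: contraNneq al => ->.
split; first by rewrite Gauss_dvdp // dd_c.
have d0 : dd a != 0 by apply: contraNneq c0 => d0; have := dd_c a as_; rewrite d0 dvd0p.
have l0 : \prod_(b <- l) dd b != 0.
  by rewrite -size_poly_gt0 (leq_trans _ sz).
rewrite size_mul //.
have : (1 < size (dd a))%N.
  by rewrite ltn_neqAle size_poly_gt0 d0 eq_sym size_poly_eq1 d1.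
case: (size (dd a)) => [|[|n]] // _; rewrite !addSn /= ltnS.
exact: leq_trans sz (leq_addl _ _).
Qed.

Lemma bezout_family (T : finType) (w : T -> {poly K}) :
  coprime_family (fun q => exists j, q = w j) ->
  exists p : T -> {poly K}, \sum_j p j * w j = 1.
Proof.
move=> cop.
suff [p pP] : exists p : T -> {poly K}, forall j, j \in enum T ->
    \sum_(i <- enum T) p i * w i %| w j.
  set g := \sum_(i <- enum T) p i * w i in pP.
  have : g %= 1 by apply: cop => q [j ->]; apply: pP; rewrite mem_enum.
  rewrite -size_poly_eq1 => /size_poly1P[c c0 gE].
  exists (fun i => c^-1 *: p i).
  under eq_bigr do rewrite -scalerAl.
  by rewrite -scaler_sumr -big_enum /= -/g gE -mul_polyC -polyCM mulVf.
elim: (enum T) (enum_uniq T) => [|i s IHs] /=; first by exists (fun=> 0).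
move=> /andP[is_ us]; have [p pP] := IHs us.
set g := \sum_(i <- s) p i * w i in pP.
have [[u1 u2] /= gE] := Bezoutp g (w i).
exists (fun k => if k == i then u2 else u1 * p k) => j.
rewrite big_cons eqxx.
have -> : \sum_(k <- s) (if k == i then u2 else u1 * p k) * w k = u1 * g.
  rewrite /g mulr_sumr; apply: eq_big_seq => k ks.
  by rewrite ifN ?mulrA //; apply: contraNneq is_ => <-.
rewrite addrC (eqp_dvdl _ gE) inE => /orP[/eqP ->|/pP js].
  exact: dvdp_gcdr.
exact: dvdp_trans (dvdp_gcdl _ _) js.
Qed.

Variables (k m : nat) (B : 'M[{poly K}]_(k, m)) (u : 'I_k -> {poly K}).

Let comb (l : 'I_k -> K) j := \sum_i (u i + (l i)%:P) * B i j.

Let upd (l : 'I_k -> K) i a := fun i' => if i' == i then l i' + a else l i'.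

Let combU l i a j : comb (upd l i a) j = comb l j + a *: B i j.
Proof.
rewrite /comb /upd; transitivity (\sum_i' ((u i' + (l i')%:P) * B i' j
    + (if i' == i then a *: B i' j else 0))).
  apply: eq_bigr => i' _; case: eqP => _; last by rewrite addr0.
  by rewrite polyCD addrA [LHS]mulrDl mul_polyC.
by rewrite big_split -big_mkcond big_pred1_eq.
Qed.

(** If [r1], [r2] are rows with a nonzero minor [mu], primes dividing [mu] are
    dealt with by running through all rows, which have no common factor.  The
    other primes cannot divide [r2]; once the minor of [w] and [r2] is nonzero,
    a further multiple of [r2] clears the primes dividing that minor, and no
    other prime can divide [w], since the minor of [w + a r2] and [r2] does not
    depend on [a]. *)
Lemma generic_combination (T : K -> Prop) :
  T 0 -> (forall a b, T a -> T b -> T (a + b)) ->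
  (forall n, exists s, [/\ uniq s, size s = n & forall a, a \in s -> T a]) ->
  coprime_family (fun q => exists i j, q = B i j) ->
  (exists i1 i2 j1 j2, B i1 j1 * B i2 j2 != B i1 j2 * B i2 j1) ->
  exists l : 'I_k -> K, (forall i, T (l i)) /\
    coprime_family (fun q => exists j, q = comb l j).
Proof.
move=> T0 TD Tinf copB [i1 [i2 [j1 [j2 mu0]]]].
set mu := B i1 j1 * B i2 j2 - B i1 j2 * B i2 j1.
rewrite -subr_eq0 -/mu in mu0.
have updT l i a : (forall i, T (l i)) -> T a -> forall i', T (upd l i a i').
  by move=> Tl Ta i'; rewrite /upd; case: ifP => _ //; apply: TD.
have step1 p : (p <= k)%N -> exists l : 'I_k -> K, (forall i, T (l i)) /\
   coprime_family (fun q =>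
     (q = mu \/ exists (i : 'I_k) (j : 'I_m), (p <= i)%N /\ q = B i j)
     \/ exists j, q = comb l j).
  elim: p => [|p IHp] pk.
    exists (fun=> 0); split=> // d dP; apply: copB => q [i [j ->]].
    by apply: dP; left; right; exists i, j.
  have [l [Tl cl]] := IHp (ltnW pk).
  pose i := Ordinal pk.
  have [s [us ss sT]] := Tinf (size mu).
  have [|||||a as_ ca] := @coprime_pencil 'I_m
    (fun q => q = mu \/ exists (i : 'I_k) (j : 'I_m), (p < i)%N /\ q = B i j)
    mu (comb l) (B i) s => //.
  - by left.
  - move=> d dP; apply: cl => q [[->|[i' [j [pi ->]]]]|[j ->]].
    + by apply: dP; left; left.
    + move: pi; rewrite leq_eqVlt => /orP[/eqP pi|pi].
        have -> : i' = i by apply: val_inj.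
        by apply: dP; right; exists j; right.
      by apply: dP; left; right; exists i', j.
    + by apply: dP; right; exists j; left.
  - by rewrite ss.
  exists (upd l i a); split; first by apply: updT => //; apply: sT.
  move=> d dP; apply: ca => q [h|[j ->]]; first by apply: dP; left.
  by rewrite -combU; apply: dP; right; exists j.
have [l [Tl cl]] := step1 k (leqnn _).
pose cdet l := comb l j1 * B i2 j2 - comb l j2 * B i2 j1.
have cdetU l' i a : cdet (upd l' i a) =
    cdet l' + a *: (B i j1 * B i2 j2 - B i j2 * B i2 j1).
  by rewrite /cdet !combU -!mul_polyC; ring.
(* The combination is now coprime to mu. Adding a multiple of row i1 makes it
   independent of row i2 on the columns j1 and j2, at the cost of excluding at
   most one more constant: hence the additional element in the supply. *)
have [s [us ss sT]] := Tinf (size mu).+1.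
pose s' := [seq a <- s | cdet (upd l i1 a) != 0].
have ss' : (size mu <= size s')%N.
  have : (size [seq a <- s | cdet (upd l i1 a) == 0%R] <= 1)%N.
    case E : [seq _ <- _ | _] => [|a [|b z]] //.
    have := filter_uniq (fun a => cdet (upd l i1 a) == 0) us.
    have ha : a \in [seq a <- s | cdet (upd l i1 a) == 0] by rewrite E mem_head.
    have hb : b \in [seq a <- s | cdet (upd l i1 a) == 0] by rewrite E !inE eqxx orbT.
    move: ha hb; rewrite !mem_filter !cdetU -/mu => /andP[/eqP ha _] /andP[/eqP hb _].
    have muE e : cdet l + e *: mu = 0 -> e *: mu = - cdet l.
      by move=> h; apply/eqP; rewrite -addr_eq0 addrC h.
    have : (a - b) *: mu = 0 by rewrite scalerBl (muE _ ha) (muE _ hb) subrr.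
    move/eqP; rewrite scaler_eq0 (negPf mu0) orbF subr_eq0 => /eqP ab.
    by rewrite E /= ab mem_head.
  have := count_predC (fun a => cdet (upd l i1 a) == 0) s.
  rewrite ss -!size_filter => e h; rewrite -ltnS -e.
  by rewrite -[X in (_ <= X)%N]add1n; apply: leq_add.
have [|||||a as_ ca] := @coprime_pencil 'I_m (fun q => q = mu)
    mu (comb l) (B i1) s' => //.
- move=> d dP; apply: cl => q [[->|[i' [j [pi _]]]]|[j ->]].
  + by apply: dP; left.
  + by move: (ltn_ord i'); rewrite ltnNge pi.
  + by apply: dP; right; exists j; left.
- exact: filter_uniq.
move: as_; rewrite mem_filter => /andP[cl0 as_].
set l1 := upd l i1 a in cl0.
have Tl1 : forall i, T (l1 i) by apply: updT => //; apply: sT.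
have [z [uz sz zT]] := Tinf (size (cdet l1)).
have [|||||b bz cb] := @coprime_pencil 'I_m (fun q => q = cdet l1)
    (cdet l1) (comb l1) (B i2) z => //.
- move=> d dP; apply: ca => q [->|[j ->]].
    rewrite /mu; apply: dvdp_sub; apply: dvdp_mull; apply: dP; right.
      by exists j2; right.
    by exists j1; right.
  by rewrite -combU; apply: dP; right; exists j; left.
- by rewrite sz.
exists (upd l1 i2 b); split; first by apply: updT => //; apply: zT.
move=> d dP; apply: cb => q [->|[j ->]]; last by rewrite -combU; apply: dP; exists j.
have -> : cdet l1 = cdet (upd l1 i2 b) by rewrite cdetU mulrC subrr scaler0 addr0.
by rewrite /cdet; apply: dvdp_sub; apply: dvdp_mulr; apply: dP; [exists j1 | exists j2].
Qed.

End Pencil.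

(** * Rank-one summands over rings of integer-valued polynomials *)

Section UnitContentSummands.
Variables (K : fieldType) (R : realType) (v : real_valuation K R) (E : set K).
Hypothesis EV : forall x, E x -> (0%E <= v x)%O.
Let V := valuation_domain v.
Let D := int_valued E V.
Variable t : K.
Hypotheses (t0 : t != 0) (vt : (0%E < v t)%O).
Hypothesis lpD : locally_principal D.

Let ev (f : D) (x : K) := (int_valued_poly f).[x].
Let pos (a : K) := (0%E < v a)%O.

Let evD f g x : ev (f + g) x = ev f x + ev g x.
Proof. by rewrite -hornerD. Qed.
Let evM f g x : ev (f * g) x = ev f x * ev g x.
Proof. by rewrite -hornerM. Qed.
Let ev_sum (T : finType) (F : T -> D) x : ev (\sum_i F i) x = \sum_i ev (F i) x.
Proof.
apply: (big_morph (ev^~ x)) => [f g|]; first exact: evD.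
by rewrite /ev horner0.
Qed.
Let poly_sum (T : finType) (F : T -> D) :
  int_valued_poly (\sum_i F i) = \sum_i int_valued_poly (F i).
Proof. exact: (big_morph (@int_valued_poly K E V)). Qed.
Let ev_prod (T : finType) (F : T -> D) x : ev (\prod_i F i) x = \prod_i ev (F i) x.
Proof.
apply: (big_morph (ev^~ x)) => [f g|]; first exact: evM.
by rewrite /ev hornerC.
Qed.

(** The product of the [f - c] over the nonzero residues [c] of [f]. *)
Lemma complementary_support (f : D) : exists g : D, forall x, E x ->
  pos (ev g x) = ~~ pos (ev f x).
Proof.
have [r rP] := finite_residues lpD t0 vt f EV.
pose s := [seq c <- r | (0%E <= v c)%O && ~~ pos c].
have ge0 x c : E x -> c \in s -> (0%E <= v (ev f x - c))%O.
  move=> Ex; rewrite mem_filter => /andP[/andP[c0 _] _].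
  by apply: val_geB => //; apply: int_valued_ge0.
have [g gE] : exists g : D,
    int_valued_poly g = \prod_(c <- s) (int_valued_poly f - c%:P).
  apply: int_valued_ex => x Ex; rewrite horner_prod; apply: val_prod_ge0 => c cs.
  by rewrite !hornerE; apply: ge0.
exists g => x Ex; have {gE} gE : ev g x = \prod_(c <- s) (ev f x - c).
  by rewrite /ev gE horner_prod; apply: eq_bigr => c _; rewrite !hornerE.
have fx0 := int_valued_ge0 f Ex; rewrite -/(ev f x) in fx0.
rewrite gE; have [fx|fx] := boolP (pos (ev f x)); rewrite /pos.
  rewrite val_prod_eq0 ?ltxx // => c cs; apply: val_eq0; first exact: ge0.
  move: cs; rewrite mem_filter => /andP[/andP[c0 nc] _].
  apply: contra nc => h; rewrite /pos -(subKr (ev f x) c); exact: val_gtB.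
have [c cr fc] := rP x Ex; rewrite -/(ev f x) in fc.
have cs : c \in s.
  rewrite mem_filter cr andbT; apply/andP; split.
    by rewrite -(subKr (ev f x) c); apply: val_geB => //; apply: ltW.
  by apply: contra fx => h; rewrite /pos -(subrK c (ev f x)); apply: val_gtD.
rewrite (perm_big _ (perm_to_rem cs)) big_cons; apply: val_mul_gt0l => //.
by apply: val_prod_ge0 => d /mem_rem; apply: ge0.
Qed.

Lemma complementary_support_family (T : finType) (w : T -> D) :
  exists g : D, forall x, E x -> pos (ev g x) = [exists j, ~~ pos (ev (w j) x)].
Proof.
have /boolp.choice[g gP] j := complementary_support (w j).
exists (\prod_j g j) => x Ex; rewrite ev_prod.
have ge0 j : (0%E <= v (ev (g j) x))%O by apply: int_valued_ge0.
case: existsP => [[j wj]|nw].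
  rewrite (bigD1 j) //=; apply: val_mul_gt0l; first by rewrite -/(pos _) gP.
  by rewrite -big_filter; apply: val_prod_ge0.
rewrite /pos val_prod_eq0 ?ltxx // => j _; apply: val_eq0 => //.
by rewrite -/(pos _) gP // negbK; apply: contra_notT nw => wj; exists j.
Qed.

(** Each row is added with a coefficient that vanishes mod [m] where the current
    combination is already nonzero, and is a unit where it vanishes. *)
Lemma pointwise_nonzero_combination k m (B : 'M[D]_(k, m)) :
  exists u : 'rV[D]_k, forall x, E x ->
    (exists i j, ~~ pos (ev (B i j) x)) -> exists j, ~~ pos (ev ((u *m B) 0 j) x).
Proof.
suff step p : (p <= k)%N -> exists u : 'rV[D]_k, forall x, E x ->
    (exists (i : 'I_k) j, (i < p)%N /\ ~~ pos (ev (B i j) x)) ->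
    exists j, ~~ pos (ev ((u *m B) 0 j) x).
  have [u uP] := step k (leqnn _); exists u => x Ex [i [j ij]].
  by apply: uP => //; exists i, j.
elim: p => [|p IHp] pk; first by exists 0 => x _ [i [j []]].
have [u uP] := IHp (ltnW pk); pose i := Ordinal pk.
have [g gP] := complementary_support_family (fun j => (u *m B) 0 j).
exists (u + g *: delta_mx 0 i) => x Ex.
have wE j : ev (((u + g *: delta_mx 0 i) *m B) 0 j) x =
    ev ((u *m B) 0 j) x + ev g x * ev (B i j) x.
  by rewrite mulmxDl -scalemxAl -rowE !mxE evD evM.
have V0 f : (0%E <= v (ev f x))%O by apply: int_valued_ge0.
have [ex|nex] := boolP [exists j, ~~ pos (ev ((u *m B) 0 j) x)].
  move=> _; have /existsP[j wj] := ex; exists j.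
  rewrite wE; apply: contra wj => h.
  rewrite /pos -(addrK (ev g x * ev (B i j) x) (ev _ x)).
  by apply: val_gtB => //; apply: val_mul_gt0l; rewrite ?V0 // -/(pos _) gP.
move=> [i' [j [ip Bij]]].
have i'E : i' = i.
  apply: val_inj => /=; move: ip; rewrite ltnS leq_eqVlt => /orP[/eqP //|ip].
  have [|j' wj'] := uP x Ex; first by exists i', j.
  by case/negP: nex; apply/existsP; exists j'.
exists j; rewrite wE; have ng : ~~ pos (ev g x) by rewrite gP.
have wj : pos (ev ((u *m B) 0 j) x).
  by move: nex; rewrite negb_exists => /forallP/(_ j); rewrite negbK.
apply/negP => h; move: Bij; rewrite i'E /pos => /negP; apply.
have : (0%E < v (ev g x * ev (B i j) x))%O.
  rewrite -[X in v X](addKr (ev ((u *m B) 0 j) x)) addrC; exact: val_gtB.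
by rewrite vfunM (val_eq0 (V0 g) ng) add0e.
Qed.

(** Let [g_i] be dual to [w] as in [locally_principal]. Since [c] is in the ideal,
    [g_i c] is in [D], so [g_i] is a polynomial; as [g_i w_j] is in [D] for all
    [j] and some [w_j(x)] is a unit, [g_i(x)] is in [V]. *)
Lemma unit_ideal_of_constant (T : finType) (w : T -> D) (c : K) :
  c != 0 -> (exists p : T -> D, int_valued_poly (\sum_j p j * w j) = c%:P) ->
  (forall x, E x -> exists j, ~~ pos (ev (w j) x)) ->
  exists g : T -> D, \sum_j g j * w j = 1.
Proof.
move=> c0 [p pE] wx.
have [|h [h1 hP]] := lpD (b := w).
  apply: contrapT => nw; have w0 j : w j = 0.
    by apply/eqP; apply: contra_notT nw => wj; exists j.
  move: pE; rewrite big1 => [/esym/eqP|j _]; last by rewrite w0 mulr0.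
  by rewrite polyC_eq0 (negPf c0).
pose q i := \sum_k p k * h i k.
have qP i j : q i * w j = (\sum_k p k * w k) * h i j.
  rewrite /q !mulr_suml; apply: eq_bigr => k _.
  by rewrite -[in LHS]mulrA hP mulrA mulrAC.
have /boolp.choice[g gE] i :
    exists g : D, int_valued_poly g = c^-1 *: int_valued_poly (q i).
  apply: int_valued_ex => x Ex; have [j wj] := wx x Ex.
  have pv : ev (\sum_k p k * w k) x = c by rewrite /ev pE hornerC.
  have := congr1 (ev^~ x) (qP i j); rewrite !evM pv => e.
  have v0 := val_eq0 (int_valued_ge0 (w j) Ex) wj.
  rewrite hornerZ mulrC val_div_ge0 // -/(ev _ x).
  rewrite -[leRHS]adde0 -v0 -vfunM -/(ev _ x) e vfunM lee_paddr //.
  exact: int_valued_ge0.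
exists g; rewrite -h1; apply: eq_bigr => i _; apply: val_inj => /=.
have := congr1 (@int_valued_poly _ _ _) (qP i i).
rewrite /= pE gE -scalerAl => ->.
by rewrite mul_polyC scalerA mulVf // scale1r.
Qed.

Lemma maximal_ideal_infinite n : exists s : seq K,
  [/\ uniq s, size s = n & forall a, a \in s -> pos a].
Proof.
have powP i : pos (t ^+ i.+1).
  elim: i => [|i IHi]; first by rewrite expr1.
  by rewrite exprS; apply: val_mul_gt0l => //; apply: ltW.
exists [seq t ^+ i.+1 | i <- iota 0 n]; split; last 2 first.
- by rewrite size_map size_iota.
- by move=> _ /mapP[i _ ->].
rewrite map_inj_uniq ?iota_uniq // => i j.
wlog ij : i j / (i <= j)%N => [H e|].
  by case: (leqP i j) => [ij|/ltnW ij]; [apply: H|apply/esym/H].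
move=> /eqP; apply: contraTeq => nij.
have {ij nij} ij : (i < j)%N by rewrite ltn_neqAle nij.
have -> : j.+1 = (i.+1 + (j - i.+1).+1)%N by rewrite addnS subnKC.
rewrite exprD -[X in X == _]mulr1 (inj_eq (mulfI (expf_neq0 _ t0))).
by apply: contraTneq (powP (j - i.+1)%N) => <-; rewrite /pos vfun1 ltxx.
Qed.

Lemma int_valued_denominator (p : {poly K}) :
  exists c, [/\ c != 0, (0%E <= v c)%O &
    forall x, (0%E <= v x)%O -> (0%E <= v (c * p.[x]))%O].
Proof.
elim/poly_ind: p => [|p a [c [c0 vc cP]]].
  by exists 1; split=> [||x]; rewrite ?oner_neq0 ?vfun1 // horner0 mulr0 vfun0 leey.
have [d [d0 vd da]] : exists d, [/\ d != 0, (0%E <= v d)%O & (0%E <= v (d * a))%O].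
  have [va|va] := leP 0%E (v a); first by exists 1; rewrite mul1r oner_neq0 vfun1.
  have a0 : a != 0 by apply: contraTneq va => ->; rewrite vfun0 -leNgt leey.
  exists a^-1; rewrite invr_eq0 mulVf // vfun1; split=> //.
  rewrite -[a^-1]mul1r val_div_ge0 // vfun1; exact: ltW.
exists (c * d); split; [exact: mulf_neq0 | exact: val_mul_ge0 | move=> x vx].
rewrite !hornerE mulrDr; apply: val_geD; last by rewrite -mulrA; apply: val_mul_ge0.
have -> : c * d * (p.[x] * x) = (c * p.[x]) * (d * x) by ring.
by apply: val_mul_ge0; [apply: cP | apply: val_mul_ge0].
Qed.

Lemma int_valued_common_denominator (T : finType) (p : T -> {poly K}) :
  exists c, c != 0 /\ exists f : T -> D, forall j, int_valued_poly (f j) = c *: p j.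
Proof.
have /boolp.choice[c cP] j := int_valued_denominator (p j).
have c0 j : c j != 0 by case: (cP j).
have /boolp.choice[f fE] j :
    exists f : D, int_valued_poly f = (\prod_j c j) *: p j.
  apply: int_valued_ex => x Ex.
  rewrite hornerZ (bigD1 j) //= [c j * _]mulrC -mulrA; apply: val_mul_ge0.
    by rewrite -big_filter; apply: val_prod_ge0 => i _; case: (cP i).
  by case: (cP j) => _ _; apply; apply: EV.
exists (\prod_j c j); split; last by exists f.
by apply/prodf_neq0 => j _.
Qed.

Lemma int_valued_unit_content_summands : unit_content_summands D.
Proof.
move=> k m B [c cB].
have [Bmin|nmin] := pselect (minors_vanish B).
  by exists k, 1%:M; rewrite mul1mx; split=> //; exists c.
have V0 f x : E x -> (0%E <= v (ev f x))%O by apply: int_valued_ge0.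
have pos_sum (T : finType) (F : T -> D) x :
    (forall i, pos (ev (F i) x)) -> pos (ev (\sum_i F i) x).
  move=> Fx; rewrite ev_sum; apply: (big_ind pos) => // [|a b].
    by rewrite /pos vfun0 ltey.
  exact: val_gtD.
have [u uP] := pointwise_nonzero_combination B.
have [|||||l [lT cl]] := @generic_combination K k m (map_mx (@int_valued_poly _ E V) B)
  (fun i => int_valued_poly (u 0 i)) pos.
- by rewrite /pos vfun0 ltey.
- by move=> a b; apply: val_gtD.
- exact: maximal_ideal_infinite.
- move=> d dP; rewrite -size_poly_eq1 -dvdp1.
  have -> : 1 = \sum_i \sum_j int_valued_poly (c i j) * int_valued_poly (B i j).
    have := congr1 (@int_valued_poly _ _ _) cB; rewrite /= => <-.
    rewrite poly_sum; apply: eq_bigr => i _.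
    by rewrite poly_sum; apply: eq_bigr => j _.
  apply: (big_ind (dvdp d)) => [|p q|i _]; [exact: dvdp0 | exact: dvdp_add |].
  apply: (big_ind (dvdp d)) => [|p q|j _]; [exact: dvdp0 | exact: dvdp_add |].
  by apply: dvdp_mull; apply: dP; exists i, j; rewrite mxE.
- apply: contrapT => nmin'; apply: nmin => i1 i2 j1 j2.
  apply: contrapT => /eqP ne; apply: nmin'; exists i1, i2, j1, j2.
  rewrite !mxE; apply: contra ne => /eqP e; apply/eqP/val_inj; exact: e.
have /boolp.choice[L LE] i : exists f : D, int_valued_poly f = (l i)%:P.
  by apply: int_valued_ex => x _; rewrite hornerC; apply/ltW/lT.
pose u' := \row_i (u 0 i + L i).
have wE j : int_valued_poly ((u' *m B) 0 j) =
    \sum_i (int_valued_poly (u 0 i) + (l i)%:P) *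
           map_mx (@int_valued_poly _ E V) B i j.
  rewrite mxE poly_sum; apply: eq_bigr => i _.
  by rewrite !mxE -LE.
have [p pE] := bezout_family cl.
have [e [e0 [f fE]]] := int_valued_common_denominator p.
have [|||g gE] := @unit_ideal_of_constant 'I_m (fun j => (u' *m B) 0 j) e => //.
- exists f; rewrite poly_sum -[RHS]mulr1 -pE mul_polyC scaler_sumr.
  by apply: eq_bigr => j _; rewrite -wE scalerAl -fE.
- move=> x Ex; have [||j uj] := uP x => //.
    apply: contrapT => nB; have : pos (ev 1 x).
      rewrite -cB; apply: (pos_sum) => i; apply: (pos_sum) => j.
      rewrite evM; apply: val_mul_gt0r; first exact: V0.
      by apply: contra_notT nB => Bij; exists i, j.
    by rewrite /pos /ev hornerC vfun1 ltxx.
  exists j; apply: contra uj => h.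
  have -> : (u *m B) 0 j = (u' *m B) 0 j - \sum_i L i * B i j.
    rewrite !mxE -sumrB; apply: eq_bigr => i _; rewrite !mxE; ring.
  rewrite evD /pos; apply: val_gtD => //.
  have -> : ev (- \sum_i L i * B i j) x = - ev (\sum_i L i * B i j) x.
    by rewrite /ev -hornerN.
  rewrite valN; apply: pos_sum => i; rewrite evM; apply: val_mul_gt0l; last exact: V0.
  by rewrite /ev LE hornerC; apply: lT.
exists 1%N, u'; split.
  exists (\row_j g j); rewrite big_ord1 -gE.
  by apply: eq_bigr => j _; rewrite mxE.
by move=> i1 i2 j1 j2; rewrite !ord1 mulrC.
Qed.

End UnitContentSummands.

(** * Splitting off rank-one summands *)

Lemma rank_idempotent_split (F : fieldType) k m (B : 'M[F]_(k, m)) (p : 'M[F]_m) :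
  p *m p = p -> (B *m p <= B)%MS ->
  \rank B = (\rank (B *m p)%R + \rank (B - B *m p)%R)%N.
Proof.
move=> pp BpB.
have capE : (B *m p :&: (B - B *m p))%MS = 0.
  apply/eqP; rewrite -submx0; apply/rV_subP => x.
  rewrite sub_capmx => /andP[/submxP[y xE] /submxP[z xE']].
  have <- : x *m p = x by rewrite {1}xE -!mulmxA pp -xE.
  by rewrite xE' -mulmxA mulmxBl -mulmxA pp subrr mulmx0 sub0mx.
rewrite -(mxrank_disjoint_sum capE); apply: eqmx_rank; apply/andP; split.
  by rewrite -{1}(subrK (B *m p) B) addrC addmx_sub_adds.
rewrite addsmx_sub BpB /= addmx_sub // eqmx_opp; exact: BpB.
Qed.

Section StackedMatrices.
Variable D : idomainType.

Definition frac_rank k m (A : 'M[D]_(k, m)) : nat := \rank (map_mx (@tofrac D) A).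

Lemma frac_rank_eq0 k m (A : 'M[D]_(k, m)) : (frac_rank A == 0%N) = (A == 0).
Proof.
rewrite mxrank_eq0; apply/eqP/eqP => [A0|->]; last by rewrite map_mx0.
apply/matrixP => i j; apply: tofrac_inj.
by move/matrixP: A0 => /(_ i j); rewrite !mxE tofrac0.
Qed.

Lemma minors_vanish_frac_rank k m (C : 'M[D]_(k, m)) :
  minors_vanish C -> (frac_rank C <= 1)%N.
Proof.
move=> Cmin; have [->|C0] := eqVneq C 0.
  by have /eqP -> : frac_rank (0 : 'M[D]_(k, m)) == 0%N by rewrite frac_rank_eq0.
have [i0 [j0 c0]] : exists i j, C i j != 0.
  apply: contrapT => nC; move/eqP: C0; apply; apply/matrixP => i j; rewrite mxE.
  by apply/eqP; apply: contra_notT nC => Cij; exists i, j.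
pose C' := map_mx (@tofrac D) C.
have -> : frac_rank C = \rank ((C' i0 j0)^-1 *: col j0 C' *m row i0 C').
  congr (\rank _); apply/matrixP => i j; rewrite !mxE big_ord1 !mxE.
  have c0' : tofrac (C i0 j0) != 0 by rewrite tofrac_eq0.
  apply: (mulfI c0'); rewrite -[in RHS]mulrA mulVKf //.
  by rewrite -!tofracM Cmin mulrC.
exact: leq_trans (mxrankM_maxr _ _) (rank_leq_row _).
Qed.

Definition content k m (B : 'M[D]_(k, m)) : ideal D :=
  ideal_gen (fun ij : 'I_k * 'I_m => B ij.1 ij.2).

Lemma mem_content k m (B : 'M[D]_(k, m)) i j : B i j \in content B.
Proof. exact: (mem_ideal_gen (fun ij : 'I_k * 'I_m => B ij.1 ij.2) (i, j)). Qed.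

Lemma nonzero_content k m (B : 'M[D]_(k, m)) : B != 0 -> nonzero_ideal (content B).
Proof.
move=> B0; apply: contrapT => nB; move/eqP: B0; apply; apply/matrixP => i j.
rewrite mxE; apply/eqP; apply: contra_notT nB => Bij.
by exists (B i j) => //; apply: mem_content.
Qed.

Lemma ideal_mulr (J : ideal D) a b : b \in J -> a * b \in J.
Proof. exact: (@rpredZ D D^o J a b). Qed.

Hypothesis lpD : locally_principal D.
Hypothesis ucsD : unit_content_summands D.

(** The rows of [B'] generate [I^-1 N], for [N] the row space of [B] and [I] its
    content: they are the [g_a B_i], with [g] dual to the family of all entries
    of [B]. *)
Lemma primitive_part k m (B : 'M[D]_(k, m)) : B != 0 ->
  exists k' (B' : 'M[D]_(k', m)), unit_content B' /\
    forall a, a \in content B -> exists Y, a *: B' = Y *m B.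
Proof.
move=> B0; pose b (ij : 'I_k * 'I_m) := B ij.1 ij.2.
have [|h [h1 hP]] := lpD (b := b).
  apply: contrapT => nB; move/eqP: B0; apply; apply/matrixP => i j.
  rewrite mxE; apply/eqP; apply: contra_notT nB => Bij; by exists (i, j).
pose T := (('I_k * 'I_m) * 'I_k)%type.
pose B' := \matrix_(r < #|{: T}|, j < m) h (enum_val r).1 ((enum_val r).2, j).
exists #|{: T}|, B'; split.
  exists (\matrix_(r, j) ((enum_val r).1 == ((enum_val r).2, j))%:R).
  transitivity (\sum_(r : 'I_#|{: T}|)
    (fun q : T => \sum_j (q.1 == (q.2, j))%:R * h q.1 (q.2, j)) (enum_val r)).
    by apply: eq_bigr => r _; apply: eq_bigr => j _; rewrite !mxE.
  have := reindex (@enum_val T predT) (onW_bij _ (@enum_val_bij T))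
    (F := fun q : T => \sum_j (q.1 == (q.2, j))%:R * h q.1 (q.2, j)) (P := xpredT).
  move=> /(_ +%R 0) <-.
  rewrite -(pair_bigA _ (fun a i => \sum_j (a == (i, j))%:R * h a (i, j))) /= -[RHS]h1.
  apply: eq_bigr => a _.
  rewrite pair_bigA /=.
  rewrite (bigD1 a) //= -surjective_pairing eqxx mul1r big1 ?addr0 // => q qa.
  by rewrite -surjective_pairing eq_sym (negPf qa) mul0r.
move=> _ /ideal_genP[d ->]; pose W a := \matrix_(r < #|{: T}|, i < k)
  ((i == (enum_val r).2)%:R * h (enum_val r).1 a).
have WE a : b a *: B' = W a *m B.
  apply/matrixP => r j; rewrite !mxE (bigD1 (enum_val r).2) //= !mxE eqxx mul1r.
  rewrite big1 => [|i /negPf]; last by rewrite !mxE => ->; rewrite !mul0r.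
  by rewrite addr0 mulrC hP.
exists (\sum_a d a *: W a); rewrite scaler_suml mulmx_suml.
by apply: eq_bigr => a _; rewrite -scalerA WE scalemxAl.
Qed.

Lemma idempotent_of_minors k m (C c : 'M[D]_(k, m)) :
  minors_vanish C -> \sum_i \sum_j c i j * C i j = 1 -> C *m (c^T *m C) = C.
Proof.
move=> Cmin cC; apply/matrixP => l q; rewrite mulmxA !mxE.
transitivity (\sum_i \sum_j c i j * C i j * C l q); last first.
  under eq_bigr do rewrite -mulr_suml.
  by rewrite -mulr_suml cC mul1r.
apply: eq_bigr => i _; rewrite mxE mulr_suml; apply: eq_bigr => j _.
by rewrite mxE mulrAC Cmin; ring.
Qed.

(** With [C] a rank-one submodule of unit content of the row space of the
    primitive part of [B] and [p0] the projection onto it, [Q *m p0] is the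
    projection with the same image that also vanishes on the kernel of [Q]. *)
Lemma rank_one_summand k m (B : 'M[D]_(k, m)) (Q : 'M[D]_m) :
  Q *m Q = Q -> B *m Q = B -> B != 0 ->
  exists p : 'M[D]_m, [/\ p *m p = p, Q *m p = p, p *m Q = p, frac_rank p = 1%N
    & forall a, a \in content B -> exists Y, a *: p = Y *m B].
Proof.
move=> QQ BQ B0; have [k' [B' [ucB' B'B]]] := primitive_part B0.
have [l [U [[c cC] Cmin]]] := ucsD ucB'; set C := U *m B' in cC Cmin.
have CcC := idempotent_of_minors Cmin cC; set p0 := c^T *m C in CcC.
have B'Q : B' *m Q = B'.
  have [a aB a0] := nonzero_content B0; have [Y YE] := B'B a aB.
  have : a *: (B' *m Q) = a *: B' by rewrite scalemxAl YE -mulmxA BQ.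
  move=> /matrixP e; apply/matrixP => i j; have := e i j.
  by rewrite mxE [RHS]mxE => /(mulfI a0).
have CQ : C *m Q = C by rewrite -mulmxA B'Q.
have p0Q : p0 *m Q = p0 by rewrite -mulmxA CQ.
have p00 : p0 *m p0 = p0 by rewrite {1}/p0 -mulmxA CcC.
have Cp : C *m (Q *m p0) = C by rewrite mulmxA CQ.
exists (Q *m p0); split.
- by rewrite -mulmxA (mulmxA p0) p0Q p00.
- by rewrite mulmxA QQ.
- by rewrite -mulmxA p0Q.
- apply/eqP; rewrite eqn_leq lt0n frac_rank_eq0; apply/andP; split.
    rewrite /frac_rank 2!map_mxM; apply: leq_trans (mxrankM_maxr _ _) _.
    apply: leq_trans (mxrankM_maxr _ _) _; exact: minors_vanish_frac_rank.
  apply/eqP => p_eq0; have C0 : C = 0 by rewrite -Cp p_eq0 mulmx0.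
  move: cC; rewrite big1 => [/esym/eqP|i _]; first by rewrite oner_eq0.
  by rewrite big1 // => j _; rewrite C0 mxE mulr0.
move=> a /B'B[Y YE]; exists (Q *m c^T *m U *m Y).
by rewrite -[RHS]mulmxA -YE -scalemxAr /p0 /C !mulmxA.
Qed.

(** Families are indexed by [nat], with values beyond [r] left unspecified, in
    order to spare the induction on [r] the casts between ordinals. *)
Definition splits_as r m (p : nat -> 'M[D]_m) (Q : 'M[D]_m) : Prop :=
  [/\ forall i j, (i < r)%N -> (j < r)%N -> p i *m p j = if i == j then p i else 0,
      \sum_(i < r) p i = Q & forall i, (i < r)%N -> frac_rank (p i) = 1%N].

(** With [N] the row space of [B] and [P i] that of [p i], the third condition
    says that [I i P i] is contained in [N], and the fourth that it contains the
    projection of [N] to [P i]. *)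
Definition stacked_along n r k m (B : 'M[D]_(k, m)) (p : nat -> 'M[D]_m)
    (I : nat -> ideal D) : Prop :=
  [/\ forall i, (i < n)%N -> nonzero_ideal (I i),
      forall i, (i.+1 < n)%N -> {subset I i.+1 <= I i},
      forall i a, (i < n)%N -> a \in I i -> exists Y, a *: p i = Y *m B,
      forall i l j, (i < n)%N -> (B *m p i) l j \in I i
    & forall i, (n <= i < r)%N -> B *m p i = 0].

Lemma splits_as_absorb r m (p : nat -> 'M[D]_m) Q i : splits_as r p Q -> (i < r)%N ->
  p i *m Q = p i /\ Q *m p i = p i.
Proof.
move=> [po pQ _] ir; rewrite -pQ mulmx_sumr mulmx_suml.
by split; rewrite (bigD1 (Ordinal ir)) //= po // eqxx big1 ?addr0 // => j ji;
   rewrite po // ifN //; apply: contraNneq ji => e; apply/eqP/val_inj.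
Qed.

Lemma splits_as_cons r m (p : nat -> 'M[D]_m) Q q :
  splits_as r p (Q - q) ->
  q *m q = q -> Q *m q = q -> q *m Q = q -> frac_rank q = 1%N ->
  splits_as r.+1 (fun i => if i is i'.+1 then p i' else q) Q.
Proof.
move=> sp qq Qq qQ q1; have [po pQ pr] := sp.
have pq i : (i < r)%N -> p i *m q = 0 /\ q *m p i = 0.
  move=> /(splits_as_absorb sp)[pE pE'].
  rewrite -{1}pE -mulmxA mulmxBl Qq qq subrr mulmx0.
  by rewrite -pE' mulmxA mulmxBr qQ qq subrr mul0mx.
split=> [[|i] [|j] // ir jr||[|i] //].
- by have [] := pq j jr.
- by have [] := pq i ir.
- exact: po.
- by rewrite big_ord_recl /= pQ addrC subrK.
- exact: pr.
Qed.

(** The bound on the first ideal is what makes the ideals decrease: the rows left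
    after splitting off [P] lie in [N], hence have entries in the content of
    [N]. *)
Lemma stacked_matrices r n k m (B : 'M[D]_(k, m)) (Q : 'M[D]_m) :
  Q *m Q = Q -> B *m Q = B -> frac_rank Q = r -> frac_rank B = n ->
  exists p I, [/\ splits_as r p Q, stacked_along n r B p I
    & (0 < n)%N -> {subset I 0%N <= content B}].
Proof.
elim: r n B Q => [|r IHr] n B Q QQ BQ Qr Bn.
  have Q0 : Q = 0 by apply/eqP; rewrite -frac_rank_eq0 Qr.
  have B0 : B = 0 by rewrite -BQ Q0 mulmx0.
  have n0 : n = 0%N by rewrite -Bn; apply/eqP; rewrite frac_rank_eq0 B0.
  exists (fun=> 0), (fun=> content B); rewrite n0; split=> //; split=> //.
  by rewrite big_ord0.
have frankQ q : q *m q = q -> Q *m q = q -> q *m Q = q -> frac_rank q = 1%N ->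
    frac_rank (Q - q) = r.
  move=> qq Qq qQ q1; apply/succn_inj; rewrite -Qr -add1n -q1 /frac_rank.
  rewrite (@rank_idempotent_split _ _ _ (map_mx (@tofrac D) Q)
    (map_mx (@tofrac D) q)) -?map_mxM ?qq ?Qq -?map_mxB //.
  by rewrite -{1}qQ map_mxM submxMl.
have idemQ q : q *m q = q -> Q *m q = q -> q *m Q = q -> (Q - q) *m (Q - q) = Q - q.
  by move=> qq Qq qQ; rewrite mulmxBl !mulmxBr QQ qq Qq qQ subrr subr0.
have [B0|B0] := eqVneq B 0.
  have n0 : n = 0%N by rewrite -Bn; apply/eqP; rewrite frac_rank_eq0 B0.
  have Q0 : Q != 0 by rewrite -frac_rank_eq0 Qr.
  have [q [qq Qq qQ q1 _]] := rank_one_summand QQ QQ Q0.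
  have [|||p [I [sp st _]]] := IHr n B (Q - q) (idemQ q qq Qq qQ) => //.
  - by rewrite B0 mul0mx.
  - exact: frankQ.
  exists (fun i => if i is i'.+1 then p i' else q), I; rewrite n0; split=> //.
    exact: splits_as_cons.
  by split=> // i _; rewrite B0 mul0mx.
have [q [qq Qq qQ q1 qB]] := rank_one_summand QQ BQ B0.
(* The entries of B lie in its content I, so B q has rows in I P, and I P lies in
   the row space of B: the projection onto P preserves the row space of B. *)
have [Z ZE] : exists Z, B *m q = Z *m B.
  have /boolp.choice[Y YE] ij : exists Y, B ij.1 ij.2 *: q = Y *m B.
    exact/qB/mem_content.
  exists (\matrix_i \sum_j row j (Y (i, j))); apply/row_matrixP => i.
  rewrite !row_mul rowK mulmx_suml [LHS]mulmx_sum_row; apply: eq_bigr => j _.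
  by rewrite mxE -row_mul -YE /= linearZ.
pose B' := B - B *m q.
have B'B : B' = (1%:M - Z) *m B by rewrite mulmxBl mul1mx -ZE.
have B'q : B' *m q = 0 by rewrite mulmxBl -mulmxA qq subrr.
have B'Q : B' *m (Q - q) = B' by rewrite mulmxBr B'q subr0 mulmxBl BQ -mulmxA qQ.
have frankBq : frac_rank (B *m q) = 1%N.
  apply/eqP; rewrite eqn_leq lt0n frac_rank_eq0; apply/andP; split.
    by rewrite /frac_rank map_mxM (leq_trans (mxrankM_maxr _ _)) // -/(frac_rank q) q1.
  apply/eqP => Bq0; have [a aB a0] := nonzero_content B0; have [Y YE] := qB a aB.
  have : frac_rank q != 0%N by rewrite q1.
  rewrite frac_rank_eq0 => /eqP; apply; apply/matrixP => i j.
  have /matrixP/(_ i j) : a *: q = 0 by rewrite -qq scalemxAl YE -mulmxA Bq0 mulmx0.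
  by rewrite !mxE => /eqP; rewrite mulf_eq0 (negPf a0) => /eqP.
have frankB' : n = (frac_rank B').+1.
  rewrite -Bn -add1n -frankBq /frac_rank map_mxB map_mxM.
  apply: rank_idempotent_split; first by rewrite -map_mxM qq.
  by rewrite -map_mxM ZE map_mxM submxMl.
have [|||p [I [sp [Inz Idec Ip IB I0] Isub]]] :=
  IHr (frac_rank B') B' (Q - q) (idemQ q qq Qq qQ) => //.
  exact: frankQ.
have B'c i j : B' i j \in content B.
  rewrite !mxE rpredB ?mem_content //; apply: rpred_sum => l _.
  by rewrite mulrC; apply: ideal_mulr; apply: mem_content.
exists (fun i => if i is i'.+1 then p i' else q),
       (fun i => if i is i'.+1 then I i' else content B).
have sq := splits_as_cons sp qq Qq qQ q1.
have Bp i : (i < r)%N -> B *m p i = B' *m p i.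
  move=> ir; rewrite mulmxBl -mulmxA; have [po _ _] := sq.
  by have /= -> := po 0%N i.+1 isT ir; rewrite mulmx0 subr0.
have n'r : (frac_rank B' <= r)%N.
  by rewrite -(frankQ q qq Qq qQ q1) -{1}B'Q /frac_rank map_mxM mxrankM_maxr.
rewrite frankB'; split=> //; last by move=> _ x.
split=> [[|i]|[|i]|[|i] a|[|i] l j|[|i]] //=.
- by move=> _; apply: nonzero_content.
- exact: Inz.
- move=> h x /(Isub h); apply: ideal_gen_sub => -[i j]; exact: B'c.
- exact: Idec.
- by move=> _; apply: qB.
- move=> h /(Ip i a h)[Y YE]; exists (Y *m (1%:M - Z)); by rewrite -mulmxA -B'B.
- move=> _; rewrite mxE; apply: rpred_sum => i _; rewrite mulrC; apply: ideal_mulr.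
  exact: mem_content.
- move=> h; rewrite Bp; first exact: IB.
  exact: (leq_trans (h : (i < frac_rank B')%N) n'r).
- by rewrite !ltnS => h; rewrite Bp ?I0 //; case/andP: h.
Qed.

End StackedMatrices.

(** * Ranks over the fraction field *)

Section FractionRank.
Variable D : idomainType.

Lemma fraction_rep (x : {fraction D}) :
  exists d n : D, d != 0 /\ tofrac d * x = tofrac n.
Proof.
elim/quotW: x => r; exists \d_r, \n_r; split; first exact: denom_ratioP.
rewrite /tofrac; unlock FracField.tofrac; rewrite [LHS]/GRing.mul /=.
rewrite !piE; apply/eqmodP; rewrite /= FracField.equivfE /FracField.mulf.
by rewrite !numden_Ratio ?oner_neq0 ?mul1r ?mulr1 ?denom_ratioP // mulrC.
Qed.

Lemma fraction_rep_row k (x : 'rV[{fraction D}]_k) :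
  exists (d : D) (n : 'rV[D]_k), d != 0 /\ tofrac d *: x = map_mx (@tofrac D) n.
Proof.
have /boolp.choice[d /boolp.choice[n dn]] i := fraction_rep (x 0 i).
have d0 i : d i != 0 by case: (dn i).
exists (\prod_i d i), (\row_i ((\prod_(j | j != i) d j) * n i)); split.
  by apply/prodf_neq0 => i _.
apply/rowP => i; rewrite !mxE (bigD1 i) //= !tofracM [tofrac (d i) * _]mulrC.
by rewrite -mulrA; case: (dn i) => _ ->.
Qed.

Lemma frac_rank_full k m (X : 'M[D]_(k, m)) :
  (forall c : 'rV_k, c *m X = 0 -> c = 0) -> frac_rank X = k.
Proof.
move=> Xfree; apply/eqP/inj_row_free => x xX.
have [d [n [d0 xE]]] := fraction_rep_row x.
have n0 : n = 0.
  apply: Xfree; apply/eqP; rewrite -frac_rank_eq0 /frac_rank map_mxM -xE.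
  by rewrite -scalemxAl xX scaler0 mxrank0.
apply/eqP; move/eqP: xE; rewrite n0 map_mx0 scaler_eq0 tofrac_eq0 (negPf d0).
by [].
Qed.

Lemma frac_rank_rowsub k m (X : 'M[D]_(k, m)) :
  exists f : 'I_(frac_rank X) -> 'I_k,
    forall c : 'rV_(frac_rank X), c *m rowsub f X = 0 -> c = 0.
Proof.
exists (maxrankfun (map_mx (@tofrac D) X)) => c cX.
have /eqP := congr1 (map_mx (@tofrac D)) cX.
rewrite map_mxM map_mx0.
have -> : map_mx (@tofrac D) (rowsub (maxrankfun (map_mx (@tofrac D) X)) X) =
  rowsub (maxrankfun (map_mx (@tofrac D) X)) (map_mx (@tofrac D) X).
  by apply/matrixP => i j; rewrite !mxE.
rewrite mulmx_free_eq0 ?maxrowsub_free // => /eqP c0.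
apply/rowP => i; have /rowP/(_ i) := c0; rewrite !mxE => /eqP.
by rewrite tofrac_eq0 => /eqP.
Qed.

End FractionRank.

(** * Transfer to modules *)

Lemma free_coordinates (D : idomainType) (M : lmodType D) m : free_of_rank M m ->
  exists (coord : {linear M -> 'rV[D]_m}) (phi : {linear 'rV[D]_m -> M}),
    cancel coord phi /\ cancel phi coord.
Proof.
move=> [b [bgen bind]].
pose phi0 (c : 'rV[D]_m) := \sum_i c 0 i *: b i.
have phi_lin : linear phi0.
  move=> a x y; rewrite /phi0 scaler_sumr -big_split; apply: eq_bigr => i _ /=.
  by rewrite !mxE scalerDl scalerA.
have /boolp.choice[coord0 coordK] x : exists c, phi0 c = x.
  have [c ->] := bgen x; exists (\row_i c i); apply: eq_bigr => i _.
  by rewrite mxE.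
pose phi : {linear 'rV[D]_m -> M} :=
  HB.pack phi0 (GRing.isLinear.Build D _ _ _ phi0 phi_lin).
have phi_inj : injective phi.
  move=> x y xy; apply/eqP; rewrite -subr_eq0; apply/eqP/rowP => i; rewrite [RHS]mxE.
  apply: (bind (fun i => (x - y) 0 i)); rewrite -/(phi0 (x - y)) -[phi0 _]/(phi (x - y)).
  by rewrite linearB xy subrr.
have phiK : cancel phi coord0 by move=> c; apply: phi_inj; rewrite [LHS]coordK.
have coord_lin : linear coord0.
  move=> a x y; apply: phi_inj; rewrite linearP [LHS]coordK.
  by rewrite -[phi (coord0 x)]/(phi0 _) -[phi (coord0 y)]/(phi0 _) !coordK.
pose coord : {linear M -> 'rV[D]_m} :=
  HB.pack coord0 (GRing.isLinear.Build D _ _ _ coord0 coord_lin).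
by exists coord, phi.
Qed.

Section FixedSubmodule.
Variables (D : idomainType) (M : lmodType D) (f : {linear M -> M}).

Definition fixed_pred : pred M := fun x => f x == x.

Lemma fixed_closed : subsemimod_closed fixed_pred.
Proof.
apply: GRing.submod_closed_semi; split=> [|a x y]; rewrite !unfold_in /fixed_pred.
  by rewrite linear0.
by move=> /eqP fx /eqP fy; rewrite linearP fx fy.
Qed.

HB.instance Definition _ :=
  GRing.isSubmodClosed.Build D M fixed_pred fixed_closed.

Definition fixed : submodClosed M := GRing.SubmodClosed.clone D M fixed_pred _.

End FixedSubmodule.

Section Coordinates.
Variables (D : idomainType) (M : lmodType D) (m : nat).
Variables (coord : {linear M -> 'rV[D]_m}) (phi : {linear 'rV[D]_m -> M}).
Hypotheses (coordK : cancel coord phi) (phiK : cancel phi coord).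

Definition matrix_image (A : 'M[D]_m) : submodClosed M :=
  fixed (phi \o mulmxr A \o coord).

Lemma mem_matrix_image A x : (x \in matrix_image A) = (coord x *m A == coord x).
Proof.
rewrite unfold_in /= /fixed_pred /=; apply/eqP/eqP => [e|->]; last exact: coordK.
by rewrite -[RHS](congr1 coord e) phiK.
Qed.

Lemma phi_image A (c : 'rV[D]_m) : A *m A = A -> phi (c *m A) \in matrix_image A.
Proof. by move=> AA; rewrite mem_matrix_image phiK -mulmxA AA. Qed.

(** A map from [P] is lifted on the images [q i] of the basis under the
    projection, and extended by the coordinates of the ambient module. *)
Lemma matrix_image_projective A : A *m A = A -> projective (submod_of (matrix_image A)).
Proof.
move=> AA X Y g f gsurj.
pose q i : submod_of (matrix_image A) := SubmodOf (phi_image (delta_mx 0 i) AA).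
have /boolp.choice[a aP] i := gsurj (f (q i)).
pose h0 (p : submod_of (matrix_image A)) := \sum_i coord (val p) 0 i *: a i.
have h_lin : linear h0.
  move=> c x y; rewrite /h0 scaler_sumr -big_split; apply: eq_bigr => i _ /=.
  by rewrite !linearP !mxE scalerDl scalerA.
pose h : {linear submod_of (matrix_image A) -> X} :=
  HB.pack h0 (GRing.isLinear.Build D _ _ _ h0 h_lin).
exists h => p; rewrite -[h p]/(h0 p) /h0 linear_sum.
have qE : \sum_i coord (val p) 0 i *: q i = p; last first.
  rewrite -[in RHS]qE [RHS]linear_sum; apply: eq_bigr => i _.
  by rewrite !linearZ aP.
apply: val_inj; rewrite linear_sum.
under eq_bigr do rewrite linearZ /= -linearZ /= scalemxAl.
rewrite -linear_sum -mulmx_suml -row_sum_delta.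
have := submod_valP p; rewrite mem_matrix_image => /eqP ->.
exact: coordK.
Qed.

Section Rank.
Variables (N : submodClosed M) (k : nat) (B : 'M[D]_(k, m)).
Hypothesis NB : forall x, x \in N -> exists u, coord x = u *m B.
Hypothesis BN : forall u, phi (u *m B) \in N.

Lemma lin_indep_frac_rank l (b : 'I_l -> submod_of N) :
  lin_indep b -> (l <= frac_rank B)%N.
Proof.
move=> bind.
have /boolp.choice[u uE] i := NB (submod_valP (b i)).
pose X : 'M[D]_(l, m) := \matrix_i coord (submod_val (b i)).
have <- : frac_rank X = l.
  apply: frac_rank_full => c cX; apply/rowP => i; rewrite [RHS]mxE.
  apply: (bind (fun i => c 0 i)); apply: val_inj; rewrite linear_sum linear0.
  apply: (can_inj coordK); rewrite linear_sum linear0 -[RHS]cX mulmx_sum_row.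
  by apply: eq_bigr => j _; rewrite !linearZ rowK.
have -> : X = (\matrix_i u i) *m B.
  by apply/row_matrixP => i; rewrite row_mul !rowK uE.
by rewrite /frac_rank map_mxM mxrankM_maxr.
Qed.

Lemma lin_indep_exists : exists b : 'I_(frac_rank B) -> submod_of N, lin_indep b.
Proof.
have [f fP] := frac_rank_rowsub B.
have rN i : phi (row (f i) B) \in N by rewrite rowE.
exists (fun i => SubmodOf (rN i)) => c c0 i.
have : \row_i c i = 0.
  apply: fP; apply: (can_inj phiK); rewrite linear0 mulmx_sum_row linear_sum.
  have e := congr1 val c0; rewrite linear_sum linear0 in e; rewrite -[RHS]e.
  by apply: eq_bigr => j _; rewrite !linearZ /= mxE row_rowsub.
by move/rowP/(_ i); rewrite !mxE.
Qed.

Lemma has_rank_frac_rank : has_rank (submod_of N) (frac_rank B).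
Proof. by split; [exact: lin_indep_exists | exact: lin_indep_frac_rank]. Qed.

End Rank.

Lemma has_rank_unique (N : lmodType D) n n' : has_rank N n -> has_rank N n' -> n = n'.
Proof.
move=> [[b bi] bm] [[b' bi'] bm'].
by apply/eqP; rewrite eqn_leq (bm' _ _ bi) (bm _ _ bi').
Qed.

Lemma matrix_image_rank A :
  A *m A = A -> has_rank (submod_of (matrix_image A)) (frac_rank A).
Proof.
move=> AA; apply: has_rank_frac_rank => [x|u]; last exact: phi_image.
by rewrite mem_matrix_image => /eqP <-; exists (coord x).
Qed.

Lemma smul_sub (I : ideal D) (P : submodClosed M) : {subset smul I P <= P}.
Proof.
move=> x /asboolP[k [a [p [_ pP ->]]]]; apply: rpred_sum => i _.
exact: rpredZ.
Qed.

Lemma image_components_unique r (p : nat -> 'M[D]_m) Q n (y y' : {ffun 'I_n -> M}) :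
  splits_as r p Q -> (n <= r)%N ->
  (forall j, y j \in matrix_image (p j)) -> (forall j, y' j \in matrix_image (p j)) ->
  \sum_j y j = \sum_j y' j -> y = y'.
Proof.
move=> [po _ _] nr yP y'P e.
suff comp (z : {ffun 'I_n -> M}) j : (forall j, z j \in matrix_image (p j)) ->
    z j = phi (coord (\sum_j z j) *m p j).
  by apply/ffunP => j; rewrite (comp y) // e -comp.
move=> zP; have zE i : coord (z i) *m p i = coord (z i).
  by have := zP i; rewrite mem_matrix_image => /eqP.
rewrite linear_sum mulmx_suml (bigD1 j) //= zE big1 ?addr0 ?coordK // => i ij.
rewrite -zE -mulmxA po ?(leq_trans (ltn_ord _)) // ifN ?mulmx0 //.
Qed.

Lemma stacked_bases_of_matrices n k (B : 'M[D]_(k, m)) (N : submodClosed M)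
    (le_nm : (n <= m)%N) p I :
  (forall x, x \in N -> exists u, coord x = u *m B) ->
  (forall u, phi (u *m B) \in N) ->
  splits_as m p 1%:M -> stacked_along n m B p I ->
  exists (P : 'I_m -> submodClosed M) (I : 'I_n -> ideal D),
    [/\ forall j, projective (submod_of (P j)) /\ has_rank (submod_of (P j)) 1,
        forall j, nonzero_ideal (I j),
        internal_dsum predT P,
        internal_dsum N (fun j => smul (I j) (P (widen_ord le_nm j)))
      & forall j k : 'I_n, k = j.+1 :> nat -> {subset I k <= I j}].
Proof.
move=> NB BN sp [Inz Idec Ip IB I0]; have [po pQ pr] := sp.
have pp i : (i < m)%N -> p i *m p i = p i by move=> im; rewrite po // eqxx.
have sumE x : x = \sum_(i < m) phi (coord x *m p i).
  by rewrite -linear_sum -mulmx_sumr pQ mulmx1 coordK.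
exists (fun j => matrix_image (p j)), (fun j => I j); split.
- move=> j; split; first exact/matrix_image_projective/pp.
  by rewrite -(pr j) //; apply/matrix_image_rank/pp.
- by move=> j; apply: Inz.
- split=> // x _; exists [ffun j : 'I_m => phi (coord x *m p j)]; split.
    split=> [j|]; first by rewrite ffunE phi_image // pp.
    by under eq_bigr do rewrite ffunE; apply: sumE.
  move=> y [yP xE]; apply: (image_components_unique sp (leqnn m)) => //.
    by move=> j; rewrite ffunE phi_image // pp.
  by rewrite -xE; under eq_bigr do rewrite ffunE; rewrite -sumE.
- split=> [j x /asboolP[l [a [q [aI qP ->]]]]|x xN].
    apply: rpred_sum => i _; have [Y YE] := Ip j _ (ltn_ord j) (aI i).
    have := qP i; rewrite mem_matrix_image => /eqP qE.
    rewrite -(coordK (q i)) -qE -linearZ scalemxAr YE mulmxA; exact: BN.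
  have [u uE] := NB x xN.
  have yN j : (j < n)%N -> phi (coord x *m p j) \in smul (I j) (matrix_image (p j)).
    move=> jn; have jm := leq_trans jn le_nm.
    apply/asboolP; exists m, (fun i => (coord x *m p j) 0 i), (fun i => phi (row i (p j))).
    split=> [i|i|].
    + rewrite uE -mulmxA mxE; apply: rpred_sum => l _.
      by apply: ideal_mulr; apply: IB.
    + by rewrite rowE phi_image // pp.
    + rewrite -{1}(pp j jm) mulmxA mulmx_sum_row linear_sum.
      by apply: eq_bigr => i _; rewrite linearZ.
  have xE : x = \sum_(j < n) phi (coord x *m p j).
    rewrite (big_ord_widen m (fun j => phi (coord x *m p j)) le_nm) big_mkcond /=.
    rewrite {1}(sumE x); apply: eq_bigr => i _; case: ifPn => // ni.
    by rewrite uE -mulmxA I0 ?mulmx0 ?linear0 // leqNgt ni ltn_ord.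
  exists [ffun j : 'I_n => phi (coord x *m p j)]; split.
    split=> [j|]; first by rewrite ffunE; apply: yN.
    by under eq_bigr do rewrite ffunE.
  move=> y [yP yE]; apply: (image_components_unique sp le_nm) => //.
  + by move=> j; rewrite ffunE; apply: smul_sub (yN j _).
  + by move=> j; apply: smul_sub (yP j).
  + by rewrite -yE; under eq_bigr do rewrite ffunE.
- by move=> j l lj; have := Idec j; rewrite -lj; apply.
Qed.

End Coordinates.

Lemma locally_principal_stacked_bases (D : idomainType) :
  locally_principal D -> unit_content_summands D -> stacked_bases_property D.
Proof.
move=> lpD ucsD M m /free_coordinates[coord [phi [coordK phiK]]] N n le_nm.
move=> [k [g gN]] rankN.
pose B : 'M[D]_(k, m) := \matrix_i coord (submod_val (g i)).
have phiB u : phi (u *m B) = submod_val (\sum_i u 0 i *: g i).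
  rewrite -[RHS]/(val _) linear_sum mulmx_sum_row linear_sum.
  by apply: eq_bigr => i _; rewrite !linearZ rowK coordK.
have BN u : phi (u *m B) \in N by rewrite phiB; apply: submod_valP.
have NB x : x \in N -> exists u, coord x = u *m B.
  move=> xN; have [c xE] := gN (SubmodOf xN); exists (\row_i c i).
  rewrite -[RHS]phiK phiB; congr (coord _).
  rewrite -[LHS]/(submod_val (SubmodOf xN)) xE; congr submod_val.
  by apply: eq_bigr => i _; rewrite mxE.
have Bn : frac_rank B = n := has_rank_unique (has_rank_frac_rank coordK phiK NB BN) rankN.
have f1 : frac_rank (1%:M : 'M[D]_m) = m by rewrite /frac_rank map_mx1 mxrank1.
have [p [I [sp st _]]] := stacked_matrices lpD ucsD (mulmx1 1%:M) (mulmx1 B) f1 Bn.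
exact: (stacked_bases_of_matrices coordK phiK le_nm NB BN sp st).
Qed.

Theorem corollary4p5 (K : fieldType) (R : realType) (v : real_valuation K R)
    (E : set K) :
  rank_one v ->
  (forall x, E x -> x \in valuation_domain v) ->
  prufer_domain (int_valued E (valuation_domain v)) ->
  stacked_bases_property (int_valued E (valuation_domain v)).
Proof.
move=> [x x0 vx] EV /prufer_locally_principal lpD.
have [t [t0 vt]] : exists t, t != 0 /\ (0%E < v t)%O.
  have [vx_gt0|vx_le0] := ltP 0%E (v x); first by exists x.
  exists x^-1; rewrite invr_eq0 -[x^-1]mul1r val_div_gt0 // vfun1.
  by rewrite lt_neqAle vx vx_le0.
exact: locally_principal_stacked_bases lpD
  (int_valued_unit_content_summands EV t0 vt lpD).
Qed.
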